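(* Let $x_0\in X=\mathrm{SL}(3,\mathbb{R})/\mathrm{SL}(3,\mathbb{Z})$ and $0<\gamma<1$. Let $Z_{x_0}(\gamma)$ be the set of $u\in\overline{B^U_1}$ such that $\delta^T_{A^+,ux_0}$ accumulates as $T\to\infty$ to some $A$-invariant finite Borel measure $\mu$ on $X$ with $$1-\gamma<\mu(X)\leq 1\quad\text{and}\quad h_{\widehat{\mu}}(a_1)\leq\gamma,$$ where $\widehat{\mu}=\mu(X)^{-1}\mu$. Then $$\dim_H Z_{x_0}(\gamma)\leq 15\sqrt{\gamma}.$$
   Context: $G=\mathrm{SL}(3,\mathbb{R})$, $\Gamma=\mathrm{SL}(3,\mathbb{Z})$, $X=G/\Gamma$. $A<G$ is the group of positive diagonal matrices of determinant one, acting on $X$ by left multiplication. For $s,t\in\mathbb{R}$, $a_{s,t}=\mathrm{diag}(e^{-s-t},e^s,e^t)\in A$; $A^+=\{a_{s,t}: s,t\geq 0\}$; $a_1=a_{1,0}=\mathrm{diag}(e^{-1},e,1)$. $U$ is the closed subgroup of $G$ of matrices $u=\begin{pmatrix}1&0&0\\ u_1&1&0\\ u_2&0&1\end{pmatrix}$, $u_1,u_2\in\mathbb{R}$, with the metric $d_U(u,v)=\max\{|u_1-v_1|,|u_2-v_2|\}$; for $\rho>0$, $B^U_\rho=\{u\in U: d_U(e,u)<\rho\}$, where $e$ is the identity, so $\overline{B^U_1}=\{u\in U:|u_1|,|u_2|\le 1\}$. $\dim_H$ is Hausdorff dimension (with respect to $d_U$). For $x\in X$ and $T>0$, the $T$-empirical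 measure is the Borel probability measure $\delta^T_{A^+,x}=\frac{1}{T^2}\int_{[0,T]^2}\delta_{a_{s,t}x}\,ds\,dt$ on $X$, where $\delta_y$ is the Dirac measure at $y$. A sequence $\{\mu_k\}$ of Borel probability measures on $X$ converges to a finite Borel measure $\mu$ on $X$ if $\int_X f\,d\mu_k\to\int_X f\,d\mu$ for every $f\in C_0(X)$ (then $\mu(X)\le1$). One says $\delta^T_{A^+,x}$ accumulates to $\mu$ as $T\to\infty$ if there is a sequence $T_k\to\infty$ in $\mathbb{R}_{>0}$ such that $\delta^{T_k}_{A^+,x}$ converges to $\mu$ (such a $\mu$ is automatically $A$-invariant). $h_\nu(a)$ is the measure-theoretic (Kolmogorov–Sinai) entropy, with natural logarithm, of the action of $a$ on $X$ with respect to the $a$-invariant Borel probability measure $\nu$. *)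

(* Defs.v *)
From HB Require Import structures.
From mathcomp Require Import all_boot all_order all_algebra ring lra.
From mathcomp Require Import generic_quotient.
From mathcomp Require Import all_classical all_reals all_analysis.

Set Implicit Arguments.
Unset Strict Implicit.
Unset Printing Implicit Defensive.

Import Order.TTheory GRing.Theory Num.Theory.
Import numFieldNormedType.Exports.

Local Open Scope classical_set_scope.
Local Open Scope ring_scope.

Section hausdorff_dimension.
Local Open Scope ereal_scope.
Context {R : realType} {M : metricType R}.
Implicit Types (A E : set M) (F : (set M)^nat) (s delta : R).

Definition diameter E : \bar R :=
  ereal_sup [set r | r = 0 \/ exists x y, [/\ E x, E y & r = (mdist x y)%:E]].

(* The empty set contributes 0 even when s = 0, since 0 `^ 0 = 1. *)
Definition hausdorff_weight s E : \bar R :=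
  if pselect (E = set0) then 0 else diameter E `^ s.

Definition hausdorff_premeasure s delta A : \bar R :=
  ereal_inf [set \sum_(0 <= i <oo) hausdorff_weight s (F i) |
    F in [set F | A `<=` \bigcup_i F i /\
                  forall i, diameter (F i) <= delta%:E]].

Definition hausdorff_measure s A : \bar R :=
  ereal_sup [set hausdorff_premeasure s delta A |
    delta in [set delta | (0 < delta)%R]].

Definition hausdorff_dim A : \bar R :=
  ereal_inf [set s%:E | s in [set s | (0 <= s)%R /\ hausdorff_measure s A = 0]].

End hausdorff_dimension.

Section entropy.
Context {d} {X : measurableType d} {R : realType}.
Variable (mu : probability X R).

Definition measurable_partition k (P : 'I_k -> set X) :=
  [/\ forall i, measurable (P i), trivIset setT P & \bigcup_i P i = setT].

(* The atoms of the common refinement of P, f^-1 P, ..., f^-(n-1) P, indexed by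
   itineraries; some of them may be empty. *)
Definition itinerary_atom (f : X -> X) k (P : 'I_k -> set X) n
    (w : {ffun 'I_n -> 'I_k}) : set X :=
  [set x | forall i : 'I_n, P (w i) (iter i f x)].

Definition static_entropy (I : finType) (P : I -> set X) : R :=
  - \sum_(i : I) fine (mu (P i)) * ln (fine (mu (P i))).

(* When f preserves mu the sequence is convergent, by subadditivity. *)
Definition partition_entropy (f : X -> X) k (P : 'I_k -> set X) : R :=
  limn (fun n => static_entropy (@itinerary_atom f k P n) / n%:R).

Definition ks_entropy (f : X -> X) : \bar R :=
  ereal_sup [set h | exists k (P : 'I_k -> set X),
    measurable_partition P /\ h = (partition_entropy f P)%:E].

End entropy.

Section vague_convergence.
Context {R : realType} {X : topologicalType}.

Definition vanishes_at_infinity (f : X -> R) :=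
  forall e : R, 0 < e ->
    exists2 K : set X, compact K & forall x, ~ K x -> `|f x| < e.

End vague_convergence.

Section SL3.
Variable R : realType.

Record SL3 := MkSL3 { mx_of :> 'M[R]_3; _ : \det mx_of == 1 }.

HB.instance Definition _ := [isSub of SL3 for mx_of].
HB.instance Definition _ := [Choice of SL3 by <:].

Implicit Types g h k : SL3.

Lemma det_mx_of g : \det (mx_of g) = 1.
Proof. exact/eqP/(valP g). Qed.

Lemma mx_of_unit g : mx_of g \in unitmx.
Proof. by rewrite unitmxE det_mx_of unitr1. Qed.

Fact SL3_one_subproof : \det (1%:M : 'M[R]_3) == 1.
Proof. by rewrite det1. Qed.

Fact SL3_mul_subproof g h : \det (mx_of g *m mx_of h) == 1.
Proof. by rewrite det_mulmx !det_mx_of mulr1. Qed.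

Fact SL3_inv_subproof g : \det (invmx (mx_of g)) == 1.
Proof. by rewrite det_inv det_mx_of invr1. Qed.

Definition SL3_one : SL3 := MkSL3 SL3_one_subproof.
Definition SL3_mul g h : SL3 := MkSL3 (SL3_mul_subproof g h).
Definition SL3_inv g : SL3 := MkSL3 (SL3_inv_subproof g).

Fact SL3_mulA : associative SL3_mul.
Proof. by move=> g h k; apply: val_inj; rewrite /= mulmxA. Qed.
Fact SL3_mul1g : left_id SL3_one SL3_mul.
Proof. by move=> g; apply: val_inj; rewrite /= mul1mx. Qed.
Fact SL3_mulg1 : right_id SL3_one SL3_mul.
Proof. by move=> g; apply: val_inj; rewrite /= mulmx1. Qed.
Fact SL3_mulVg : left_inverse SL3_one SL3_inv SL3_mul.
Proof. by move=> g; apply: val_inj; rewrite /= mulVmx// mx_of_unit. Qed.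
Fact SL3_mulgV : right_inverse SL3_one SL3_inv SL3_mul.
Proof. by move=> g; apply: val_inj; rewrite /= mulmxV// mx_of_unit. Qed.

HB.instance Definition _ := isGroup.Build SL3
  SL3_mulA SL3_mul1g SL3_mulg1 SL3_mulVg SL3_mulgV.

HB.instance Definition _ := isPointed.Build SL3 SL3_one.
HB.instance Definition _ := Topological.copy SL3
  (initial_topology (mx_of : SL3 -> 'M[R]_3)).

Definition SL3Z : set SL3 :=
  [set g | forall i j, mx_of g i j \is a Num.int].

Fact SL3Z1 : SL3Z 1%g.
Proof.
by move=> i j; rewrite mxE; case: eqP => _ /=; rewrite ?rpred1 ?rpred0.
Qed.

Fact SL3ZM g h : SL3Z g -> SL3Z h -> SL3Z (g * h)%g.
Proof.
move=> gZ hZ i j; rewrite /mx_of/= mxE; apply: rpred_sum => k _.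
by rewrite rpredM.
Qed.

Fact SL3ZV g : SL3Z g -> SL3Z (g^-1)%g.
Proof.
move=> gZ i j; rewrite /mx_of/= /invmx -/(mx_of g) mx_of_unit det_mx_of invr1.
rewrite scale1r mxE /cofactor; apply: rpredM; first by rewrite rpredX ?rpredN1.
apply: rpred_sum => s _; apply: rpredM; first by rewrite rpredX ?rpredN1.
by apply: rpred_prod => k _; rewrite !mxE.
Qed.

Definition coset_rel : rel SL3 := fun g h => `[< SL3Z (g^-1 * h)%g >].

Fact coset_rel_refl : reflexive coset_rel.
Proof. by move=> g; apply/asboolP; rewrite mulVg; exact: SL3Z1. Qed.

Fact coset_rel_sym : symmetric coset_rel.
Proof.
move=> g h; apply/asboolP/asboolP => /SL3ZV; by rewrite invgM invgK.
Qed.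

Fact coset_rel_trans : transitive coset_rel.
Proof.
move=> h g k /asboolP gh /asboolP hk; apply/asboolP.
by have := SL3ZM gh hk; rewrite mulgA mulgK.
Qed.

Canonical coset_equiv := EquivRel coset_rel
  coset_rel_refl coset_rel_sym coset_rel_trans.

Definition quot_space := quotient_topology {eq_quot coset_equiv}%qT.

HB.instance Definition _ := Topological.on quot_space.
HB.instance Definition _ := Pointed.on quot_space.
HB.instance Definition _ := Quotient.on quot_space.
HB.instance Definition _ :=
  Measurable.copy quot_space (g_sigma_algebraType (@open quot_space)).

Definition quot_proj g : quot_space := \pi_quot_space%qT g.

Lemma quot_projP g h : quot_proj g = quot_proj h <-> SL3Z (g^-1 * h)%g.
Proof. by split=> [/eqquotP/asboolP|gh]; last by apply/eqquotP/asboolP. Qed.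

Definition quot_act g (x : quot_space) : quot_space := quot_proj (g * repr x)%g.

Lemma quot_act_proj g h : quot_act g (quot_proj h) = quot_proj (g * h)%g.
Proof.
apply/quot_projP.
have /quot_projP : quot_proj (repr (quot_proj h)) = quot_proj h
  by exact: reprK.
by rewrite invgM -mulgA mulKg.
Qed.

Lemma quot_act1 x : quot_act 1%g x = x.
Proof. by rewrite /quot_act mul1g; exact: reprK. Qed.

Lemma quot_actM g h x : quot_act (g * h)%g x = quot_act g (quot_act h x).
Proof. by rewrite [quot_act h x]/quot_act quot_act_proj mulgA. Qed.

Definition diag_group : set SL3 :=
  [set g | is_diag_mx (mx_of g) /\ forall i, 0 < mx_of g i i].

Definition a_mx (s t : R) : 'M[R]_3 :=
  diag_mx (\row_i [:: expR (- s - t); expR s; expR t]`_i).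

Fact det_a_mx s t : \det (a_mx s t) == 1.
Proof.
rewrite det_diag !big_ord_recl big_ord0 !mxE/= mulr1 -!expRD.
by rewrite [_ + (s + t)](_ : _ = 0) ?expR0//; lra.
Qed.

Definition a_elt s t : SL3 := MkSL3 (det_a_mx s t).

Definition horo_group : set SL3 :=
  [set u | exists u1 u2 : R,
    mx_of u = 1%:M + u1 *: delta_mx 1 0 + u2 *: delta_mx 2 0].

Record horo := MkHoro { horo_elt :> SL3; _ : horo_elt \in horo_group }.

HB.instance Definition _ := [isSub of horo for horo_elt].
HB.instance Definition _ := [Choice of horo by <:].

Fact horo1_subproof : 1%g \in horo_group.
Proof. by rewrite inE; exists 0, 0; rewrite !scale0r !addr0. Qed.

Definition horo1 : horo := MkHoro horo1_subproof.

Definition dU (u v : horo) : R :=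
  Num.max `|mx_of u 1 0 - mx_of v 1 0| `|mx_of u 2 0 - mx_of v 2 0|.

Fact dU_xx u : dU u u = 0.
Proof. by rewrite /dU !subrr normr0 maxxx. Qed.

Fact dU_eq0 u v : dU u v = 0 -> u = v.
Proof.
move=> /eqP; rewrite eq_le ge_max !normr_le0 !subr_eq0 => /andP[/andP[]].
have /set_mem[u1 [u2 uE]] := valP u; have /set_mem[v1 [v2 vE]] := valP v.
rewrite /= in uE vE; rewrite uE vE !mxE/= !mulr1n !mulr0n.
rewrite !add0r !mulr1 !mulr0 !addr0 !add0r => /eqP uv1 /eqP uv2 _.
by do 2 apply: val_inj => /=; rewrite uE vE uv1 uv2.
Qed.

Fact dU_sym u v : dU u v = dU v u.
Proof. by rewrite /dU distrC [X in Num.max _ X]distrC. Qed.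

Fact dU_triangle v u w : dU u w <= dU u v + dU v w.
Proof.
rewrite /dU ge_max; apply/andP; split.
- by rewrite (le_trans (ler_distD (mx_of v 1 0) _ _))// lerD// le_max lexx.
- by rewrite (le_trans (ler_distD (mx_of v 2 0) _ _))// lerD// le_max lexx orbT.
Qed.

HB.instance Definition _ :=
  isMetric.Build R horo dU_xx dU_eq0 dU_sym dU_triangle.

End SL3.

Lemma open_measurable_prod {R : realType} (O : set (R * R)) :
  open O -> measurable O.
Proof.
move=> oO.
pose B (q : rat * rat * rat * rat) : set (R * R) :=
  `]ratr q.1.1.1, ratr q.1.1.2[ `*` `]ratr q.1.2, ratr q.2[.
have -> : O = \bigcup_q (if asbool (B q `<=` O) then B q else set0).
  apply/seteqP; split=> [[x y] Oxy|z [q _]]; last first.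
    by case: ifPn => [/asboolP qO /qO|_].
  have : nbhs (x, y) O by exact: open_nbhs_nbhs.
  move=> /nbhs_ballP[e /= e0 eO].
  have /rat_in_itvoo[q1 /itvP q1P] : x - e < x by rewrite ltrBlDr ltrDl.
  have /rat_in_itvoo[q2 /itvP q2P] : x < x + e by rewrite ltrDl.
  have /rat_in_itvoo[q3 /itvP q3P] : y - e < y by rewrite ltrBlDr ltrDl.
  have /rat_in_itvoo[q4 /itvP q4P] : y < y + e by rewrite ltrDl.
  exists (q1, q2, q3, q4) => //; case: ifPn => [_|/asboolPn[]].
    by rewrite /B/= !in_itv/= q1P q2P q3P q4P.
  move=> [u v] [/=]; rewrite !in_itv/= => /andP[u1 u2] /andP[v1 v2].
  apply: eO; split => /=; rewrite /ball/= distrC ltr_distl.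
  - by rewrite (lt_trans _ u1) ?q1P// (lt_trans u2)// q2P.
  - by rewrite (lt_trans _ v1) ?q3P// (lt_trans v2)// q4P.
apply: countable_bigcupT_measurable => [|q]; first exact: countableP.
case: ifPn => // _.
by apply: measurableX; exact: measurable_itv.
Qed.

Lemma mx_cvg {S : topologicalType} {T : topologicalType} m n
  (f : S -> 'M[T]_(m, n)) p :
  (forall i j, f q i j @[q --> p] --> f p i j) -> f q @[q --> p] --> f p.
Proof.
move=> fp A [P PM PA].
apply: (filterS (fun q => PA (f q))).
by apply: filter_forall => i; apply: filter_forall => j; exact: fp.
Qed.

Section empirical_measure.
Context {R : realType}.
Local Notation X := (quot_space R).
Local Notation leb := (@lebesgue_measure R).

Definition square (T : R) : set (R * R) := `[0, T] `*` `[0, T].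

Variable (T : {posnum R}) (x : X).

Local Open Scope ereal_scope.

Definition empirical (E : set X) : \bar R :=
  ((T%:num ^+ 2)^-1)%:E *
  \int[leb \x leb]_(p in square T%:num) \d_(quot_act (a_elt p.1 p.2) x) E.

Lemma continuous_a_orbit :
  continuous (fun p : R * R => quot_act (a_elt p.1 p.2) x).
Proof.
have cM : continuous (fun p : R * R => (a_elt p.1 p.2 * repr x)%g : SL3 R).
  apply: continuous_comp_initial => p; apply: mx_cvg => i j.
  rewrite /= mul_diag_mx !mxE; under eq_fun do rewrite mul_diag_mx !mxE.
  apply: cvgMl.
  case: i => [[|[|[|//]]] i3] /=; last 2 first.
  - apply: (@continuous_comp _ _ _ (@fst R R) expR);
      [exact: cvg_fst|exact: continuous_expR].
  - apply: (@continuous_comp _ _ _ (@snd R R) expR);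
      [exact: cvg_snd|exact: continuous_expR].
  apply: continuous_cvg; first exact: continuous_expR.
  by apply: cvgB; [apply: cvgN; exact: cvg_fst|exact: cvg_snd].
move=> p; apply: (continuous_comp (cM p)); exact: pi_continuous.
Qed.

Lemma measurable_a_orbit :
  measurable_fun setT (fun p : R * R => quot_act (a_elt p.1 p.2) x).
Proof.
apply: (@measurability _ _ _ _ _ _ (@open X)) => //.
move=> _ [V oV <-]; rewrite setTI; apply: open_measurable_prod.
by move/continuousP : continuous_a_orbit; apply.
Qed.

Let measurable_square : measurable (square T%:num).
Proof. by apply: measurableX; exact: measurable_itv. Qed.

Lemma empiricalE (E : set X) : measurable E ->
  empirical E = ((T%:num ^+ 2)^-1)%:E *
    (leb \x leb) ((fun p : R * R => quot_act (a_elt p.1 p.2) x) @^-1` E `&`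
                  square T%:num).
Proof.
move=> mE; rewrite /empirical; congr (_ * _).
rewrite -integral_indic//; last first.
  by rewrite -[X in measurable X]setTI; exact: measurable_a_orbit.
Qed.

Let empirical0 : empirical set0 = 0.
Proof. by rewrite empiricalE// preimage_set0 set0I measure0 mule0. Qed.

Let empirical_ge0 E : 0 <= empirical E.
Proof. by rewrite mule_ge0// ?integral_ge0// lee_fin invr_ge0 exprn_ge0. Qed.

Let empirical_sigma_additive : semi_sigma_additive empirical.
Proof.
have c0 : (0 <= (T%:num ^+ 2)^-1)%R by rewrite invr_ge0 exprn_ge0.
pose nu_ := mscale (NngNum c0)
  (pushforward (mrestr (leb \x leb) measurable_square)
    (fun p : R * R => quot_act (a_elt p.1 p.2) x)) : {measure set X -> \bar R}.
pose nu := nu_ measurable_a_orbit.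
move=> F mF tF mUF.
have nuE E : measurable E -> empirical E = nu E by exact: empiricalE.
rewrite nuE//; apply: cvg_trans (measure_semi_sigma_additive _ mF tF mUF).
apply: near_eq_cvg; apply: nearW => n; apply: eq_bigr => i _.
by rewrite nuE.
Qed.

HB.instance Definition _ := isMeasure.Build _ _ _ empirical
  empirical0 empirical_ge0 empirical_sigma_additive.

Let empirical_setT : empirical setT = 1.
Proof.
have lebT : leb `[0%R, T%:num] = T%:num%:E.
  by rewrite lebesgue_measure_itv/= lte_fin gt0//= sube0.
rewrite empiricalE// preimage_setT setTI product_measure1E//.
transitivity (((T%:num ^+ 2)^-1)%:E * (T%:num%:E * T%:num%:E)).
  by congr (_ * (_ * _)); exact: lebT.
by rewrite -!EFinM -expr2 mulVf.
Qed.

HB.instance Definition _ :=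
  Measure_isProbability.Build _ _ _ empirical empirical_setT.

End empirical_measure.

Section exceptional_set.
Context {R : realType}.
Local Notation X := (quot_space R).

Definition measures_cvg (mu_ : nat -> probability X R)
    (mu : {finite_measure set X -> \bar R}) :=
  forall f : X -> R, continuous f -> vanishes_at_infinity f ->
    (fun k => \int[mu_ k]_y (f y)%:E)%E @ \oo --> (\int[mu]_y (f y)%:E)%E.

Definition is_empirical_limit (x : X) (mu : {finite_measure set X -> \bar R}) :=
  exists T_ : nat -> {posnum R},
    (fun k => (T_ k)%:num) @ \oo --> +oo /\
    measures_cvg (fun k => empirical (T_ k) x) mu.

Definition A_invariant (mu : {measure set X -> \bar R}) :=
  forall a, diag_group a ->
    forall E : set X, measurable E -> mu (quot_act a @^-1` E) = mu E.

(* The second argument of mnormalize is the value it takes when the total mass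
   is 0 or infinite; the bounds on mu setT rule this out for gamma < 1. *)
Definition exceptional_set (x0 : X) (gamma : R) : set (horo R) :=
  [set u | closed_ball (horo1 R) 1 u /\
    exists mu : {finite_measure set X -> \bar R},
      [/\ is_empirical_limit (quot_act u x0) mu,
          A_invariant mu,
          ((1 - gamma)%:E < mu setT <= 1)%E &
          (ks_entropy (mnormalize mu \d_x0) (quot_act (a_elt 1 0))
             <= gamma%:E)%E]].

End exceptional_set.

(* Main.v *)
Require Import Defs.
From mathcomp Require Import all_boot all_order all_algebra perm ring lra zify.
From mathcomp Require Import all_classical all_reals all_analysis.
From mathcomp Require Import measurable_realfun.

(* Write y for the square root of gamma. If the empirical measures of u x0 over
   [0, T]^2 accumulate to mu, take a fine partition of a large compact part of X
   whose boundary is mu-null; words of length n along a_1 then have a code with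
   mean length about gamma n for mu, and these empirical measures give mass at
   most about gamma to the complement of the compact part. Charge each word its code length plus 5
   for each time spent outside the compact part: the mean cost over [0, T]^2 is
   at most 10 gamma n. Averaging over the heights t <= y T only, some horizontal
   line t = q / K of [0, T]^2 carries words of total cost at most 11 y T.

   Along this line, nearby points of a U-orbit with the same symbol stay as
   close as before the expansion, because the injectivity radius is bounded
   below on the compact part, whereas a time spent outside multiplies the number
   of rectangles by at most e^5. Starting at height t costs e^(3 t) <= e^(3 y T)
   rectangles, and by Kraft's inequality the words and their subdivisions
   contribute at most e^(11 y T). So e^(14 y T) rectangles of diameter about
   e^(-T) cover these u, which are negligible in dimension 15 y. *)

Import Order.TTheory GRing.Theory Num.Theory.
Import numFieldNormedType.Exports.

Set Implicit Arguments.
Unset Strict Implicit.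
Unset Printing Implicit Defensive.

Local Open Scope classical_set_scope.
Local Open Scope ring_scope.

(** * Hausdorff null sets *)

(** The measure [mu] depends on u, and so do its partition and its code, whereas null sets add up
    only countably. Tightness supplies a norm bound N from a countable list, and N alone fixes the
    radius [r], the net [h] and the mesh 1 / K. The partition radius [r'], which must avoid
    countably many values depending on [mu], is taken between r / 4 and r / 2 and then forgotten:
    enlarging it to [r] absorbs both this choice and the size of a grid cell. What remains is the
    word length n and a function [l] from a finite set to the naturals, a countable choice.

    Limits are tested only on functions vanishing at infinity, so mass may escape. A cost cannot be
    tested, since it does not vanish far out, but its deficit to the cost of the all-outside word
    can. The escaped mass, less than gamma, is thereby charged as that word, whose code length must
    be bounded in advance.

    The height bound y T balances two losses: heights up to theta T cost e^(3 theta T) rectangles at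
    the start, while some line among them carries words of total cost of order gamma T / theta. *)

Section hausdorff_null.
Local Open Scope ereal_scope.
Context {R : realType} {M : metricType R}.
Implicit Types (A E : set M) (s delta : R).

Lemma diameter_ge0 E : 0 <= diameter E.
Proof. by apply: ereal_sup_ubound; left. Qed.

Lemma hausdorff_weight_ge0 s E : 0 <= hausdorff_weight s E.
Proof. by rewrite /hausdorff_weight; case: pselect => E0 //=;
  exact: poweR_ge0. Qed.

Lemma hausdorff_weight_set0 s : hausdorff_weight s (set0 : set M) = 0.
Proof. by rewrite /hausdorff_weight; case: pselect. Qed.

Lemma hausdorff_weight_le s E (d : R) : (0 <= s)%R -> diameter E <= d%:E ->
  hausdorff_weight s E <= (d `^ s)%:E.
Proof.
move=> s0 Ed; rewrite /hausdorff_weight; case: pselect => E0 /=.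
  by rewrite lee_fin powR_ge0.
rewrite -poweR_EFin; apply: gt0_ler_poweR => //.
  by rewrite in_itv/= diameter_ge0 leey.
by rewrite in_itv/= leey andbT (le_trans _ Ed)// diameter_ge0.
Qed.

Lemma hausdorff_premeasure_ge0 s delta A : 0 <= hausdorff_premeasure s delta A.
Proof.
apply: le_ereal_inf_tmp => _ [F _ <-]; apply: nneseries_ge0 => i _ _.
exact: hausdorff_weight_ge0.
Qed.

(** The usual countable subadditivity of an outer measure: covers of the [A n] that are optimal up
    to [e / 2 ^ n.+1] are merged along a bijection between nat and nat * nat. *)
Lemma hausdorff_premeasure_bigcup s delta (A : nat -> set M) :
  hausdorff_premeasure s delta (\bigcup_n A n) <=
  \sum_(n <oo) hausdorff_premeasure s delta (A n).
Proof.
set mu := hausdorff_premeasure s delta.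
have [[i ioo]|] := pselect (exists i, mu (A i) = +oo).
  rewrite (eseries_pinfty _ _ ioo) ?leey// => n _.
  by rewrite -ltNye (lt_le_trans _ (hausdorff_premeasure_ge0 _ _ _)).
rewrite -forallNE => Aoo.
suff add2e (e : {posnum R}) :
    mu (\bigcup_n A n) <= \sum_(i <oo) mu (A i) + e%:num%:E.
  by apply/lee_addgt0Pr => _/posnumP[].
rewrite (le_trans _ (epsilon_trick _ _ _))//; last first.
  by move=> n; exact: hausdorff_premeasure_ge0.
pose P n (B : (set M)^nat) :=
  [/\ A n `<=` \bigcup_i B i, forall i, diameter (B i) <= delta%:E &
  \sum_(k <oo) hausdorff_weight s (B k) <= mu (A n) + (e%:num / (2 ^
    n.+1)%:R)%:E].
have [G PG] : {G : ((set M)^nat)^nat & forall n, P n (G n)}.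
  apply: (@choice _ _ P) => n.
  have en1 : (0 < e%:num / (2 ^ n.+1)%:R)%R by [].
  have mufin : mu (A n) \is a fin_num.
    by rewrite ge0_fin_numE ?hausdorff_premeasure_ge0// lt_neqAle leey andbT;
      apply/eqP.
  have [x [B [AnB dB] muBx] xS] := lb_ereal_inf_adherent en1 mufin.
  by exists B; split => //; rewrite muBx; exact/ltW.
have w_ge0 x : 0 <= (hausdorff_weight s \o uncurry G) x.
  exact: hausdorff_weight_ge0.
apply: (@le_trans _ _ (\esum_(i in setT) (hausdorff_weight s \o uncurry G) i)).
  apply: ereal_inf_lbound => /=.
  have /card_esym/ppcard_eqP[f] := card_nat2.
  exists (uncurry G \o f).
    split=> [t [i _]|i]; last first.
      by rewrite /=; case: (f i) => a b; have [_ dG _] := PG a; exact: dG.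
    have [+ _ _] := PG i => /[apply] -[j _ Gij].
    by exists (f^-1%FUN (i, j)) => //=; rewrite invK ?inE.
  rewrite nneseries_esumT; last by move=> i; exact: hausdorff_weight_ge0.
  rewrite (reindex_esum setT setT f)//; exact: bij.
have -> : \esum_(i in setT) (hausdorff_weight s \o uncurry G) i =
    \sum_(i <oo) \sum_(j <oo) hausdorff_weight s (G i j).
  rewrite nneseries_esumT; last first.
    by move=> i; apply: nneseries_ge0 => *; exact: hausdorff_weight_ge0.
  transitivity (\esum_(i in setT) \esum_(j in setT) hausdorff_weight s (G i j));
    last first.
    apply: eq_esum => i _; rewrite nneseries_esumT// => j.
    exact: hausdorff_weight_ge0.
  rewrite esum_esum; last by move=> *; exact: hausdorff_weight_ge0.
  rewrite (_ : _ `*`` _ = setT); last by apply/seteqP; split.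
  by apply: eq_esum => -[i j] _.
apply: lee_nneseries => [n _ _|n _]; last by have [_ _] := PG n.
by apply: nneseries_ge0 => *; exact: hausdorff_weight_ge0.
Qed.

Lemma hausdorff_premeasure_le s delta (A B : set M) : A `<=` B ->
  hausdorff_premeasure s delta A <= hausdorff_premeasure s delta B.
Proof.
move=> AB; apply: ereal_inf_le_tmp => x [F [BF dF] <-]; exists F => //.
by split=> //; exact: subset_trans BF.
Qed.

Lemma hausdorff_measure_ge0 s A : 0 <= hausdorff_measure s A.
Proof.
apply: (@le_trans _ _ (hausdorff_premeasure s 1 A)).
  exact: hausdorff_premeasure_ge0.
by apply: ereal_sup_ubound; exists 1%R => //=.
Qed.

Lemma hausdorff_measure_eq0P s A :
  hausdorff_measure s A = 0 <->
  forall delta, (0 < delta)%R -> hausdorff_premeasure s delta A = 0.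
Proof.
split=> [H0 delta d0|H].
  apply/eqP; rewrite eq_le hausdorff_premeasure_ge0 andbT -H0.
  by apply: ereal_sup_ubound; exists delta.
apply/eqP; rewrite eq_le hausdorff_measure_ge0 andbT.
by apply: ge_ereal_sup => _ [delta /= d0 <-]; rewrite H.
Qed.

Lemma hausdorff_premeasure_set0 s delta : (0 < delta)%R ->
  hausdorff_premeasure s delta (set0 : set M) = 0.
Proof.
move=> d0; apply/eqP; rewrite eq_le hausdorff_premeasure_ge0 andbT.
apply: ereal_inf_lbound; exists (fun=> set0).
  split=> // _; apply: ge_ereal_sup => _ [->|[x [y []]]//].
  by rewrite lee_fin ltW.
by rewrite eseries0// => i _ _; rewrite hausdorff_weight_set0.
Qed.

Lemma hausdorff_measure_set0 s : hausdorff_measure s (set0 : set M) = 0.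
Proof. by apply/hausdorff_measure_eq0P => d /(hausdorff_premeasure_set0 s). Qed.

(** The index is any countable type because the exceptional set is split over pairs of a word length
    and a length function. *)
Lemma hausdorff_measure_bigcup0 (I : countType) s (A : I -> set M) :
  (forall i, hausdorff_measure s (A i) = 0) ->
  hausdorff_measure s (\bigcup_i A i) = 0.
Proof.
move=> A0; apply/hausdorff_measure_eq0P => delta d0.
pose B n := if unpickle n is Some i then A i else set0.
apply/eqP; rewrite eq_le hausdorff_premeasure_ge0 andbT.
apply: (@le_trans _ _ (hausdorff_premeasure s delta (\bigcup_n B n))).
  apply: hausdorff_premeasure_le => x [i _ Aix]; exists (pickle i) => //.
  by rewrite /B pickleK.
apply: (le_trans (hausdorff_premeasure_bigcup _ _ _)).
rewrite eseries0// => n _ _; rewrite /B; case: unpickle => [i|];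
  last exact: hausdorff_premeasure_set0.
by move: (A0 i) => /hausdorff_measure_eq0P; exact.
Qed.

Lemma hausdorff_measure_sub0 s (A B : set M) : A `<=` B ->
  hausdorff_measure s B = 0 -> hausdorff_measure s A = 0.
Proof.
move=> AB /hausdorff_measure_eq0P B0; apply/hausdorff_measure_eq0P => d d0.
apply/eqP; rewrite eq_le hausdorff_premeasure_ge0 andbT -(B0 _ d0).
exact: hausdorff_premeasure_le.
Qed.

Lemma hausdorff_premeasure_seq s delta (d : R) A (Fs : seq (set M)) :
  (0 <= s)%R -> (0 <= d <= delta)%R ->
  (forall x, A x -> exists2 F, F \in Fs & F x) ->
  (forall F, F \in Fs -> diameter F <= d%:E) ->
  hausdorff_premeasure s delta A <= ((size Fs)%:R * d `^ s)%:E.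
Proof.
move=> s0 /andP[d0 ddelta] AF dF.
have d00 : diameter (set0 : set M) <= 0.
  by apply: ge_ereal_sup => r [->|[x [y []]]].
(* Beyond its end the list is padded with [set0], which has weight 0 by convention, even for s =
   0. *)
apply: (@le_trans _ _ (\sum_(0 <= i <oo) hausdorff_weight s (nth set0 Fs i))).
  apply: ereal_inf_lbound; exists (nth set0 Fs) => //; split.
    move=> x /AF[F FFs Fx]; exists (index F Fs) => //=.
    by rewrite nth_index.
  move=> i; case: (ltnP i (size Fs)) => iF.
    by rewrite (le_trans (dF _ (mem_nth _ iF)))// lee_fin.
  by rewrite nth_default// (le_trans d00)// lee_fin (le_trans d0).
rewrite (nneseries_split 0 (size Fs)); last first.
  by move=> *; exact: hausdorff_weight_ge0.
rewrite add0n [X in _ + X]eseries0 ?adde0; last first.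
  by move=> i iF _; rewrite nth_default// hausdorff_weight_set0.
rewrite big_mkord (le_trans (y := \sum_(i < size Fs) (d `^ s)%:E))//.
  apply: lee_sum => i _; apply: hausdorff_weight_le => //.
  by apply: dF; exact: mem_nth.
by rewrite sumEFin sumr_const card_ord -[leRHS]EFinM mulr_natl.
Qed.

(** The convergence half of Borel-Cantelli: [A] lies in the union of the [E n] over n >= N, whose
    premeasure is bounded by the tail of a geometric series. *)
Lemma hausdorff_measure_limsup0 s A (E : nat -> set M) : (0 <= s)%R ->
  (forall x N, A x -> exists2 n, (N <= n)%N & E n x) ->
  (forall e : R, (0 < e)%R -> exists N, forall n, (N <= n)%N ->
    exists (d : R) (Fs : seq (set M)), [/\ (0 <= d <= e)%R,
      forall x, E n x -> exists2 F, F \in Fs & F x,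
      forall F, F \in Fs -> diameter F <= d%:E &
      ((size Fs)%:R * d `^ s <= (2 ^ n.+1)%:R^-1)%R]) ->
  hausdorff_measure s A = 0.
Proof.
move=> s0 AE cover; apply/hausdorff_measure_eq0P => delta delta0.
apply/eqP; rewrite eq_le hausdorff_premeasure_ge0 andbT.
have [N0 HN] := cover _ delta0.
apply/lee_addgt0Pr => e e0; rewrite add0e.
have [N1 HN1] : exists N1, ((2 ^ N1)%:R^-1 <= e :> R)%R.
  have [k _ /(_ k (leqnn _)) kP] := near_infty_natSinv_expn_lt (PosNum e0).
  by exists k; move: kP; rewrite div1r natrX => /ltW.
pose N := maxn N0 N1.
apply: (@le_trans _ _ (hausdorff_premeasure s delta (\bigcup_k E (N + k)%N))).
  apply: hausdorff_premeasure_le => x /(fun Ax => AE x N Ax)[n Nn Enx].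
  by exists (n - N)%N => //; rewrite subnKC.
apply: (le_trans (hausdorff_premeasure_bigcup _ _ _)).
have eN0 : (0 <= (2 ^ N)%:R^-1 :> R)%R by rewrite invr_ge0.
apply: (@le_trans _ _ (\sum_(k <oo) ((2 ^ N)%:R^-1 / (2 ^ k.+1)%:R)%:E)).
  apply: lee_nneseries => [k _ _|k _]; first exact: hausdorff_premeasure_ge0.
  have NkN0 : (N0 <= N + k)%N by rewrite (leq_trans (leq_maxl N0 N1))//
    leq_addr.
  have [d [Fs [d0 EF dF le]]] := HN _ NkN0.
  apply: (le_trans (hausdorff_premeasure_seq s0 d0 EF dF)).
  by rewrite lee_fin (le_trans le)// -addnS expnD natrM invfM.
apply: (le_trans (epsilon_trick0 _ eN0)).
rewrite lee_fin (le_trans _ HN1)// lef_pV2 ?posrE ?ltr0n ?expn_gt0//.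
by rewrite ler_nat leq_exp2l// leq_maxr.
Qed.

Lemma hausdorff_dim_le s A : (0 <= s)%R -> hausdorff_measure s A = 0 ->
  hausdorff_dim A <= s%:E.
Proof. by move=> s0 A0; apply: ereal_inf_lbound; exists s. Qed.

End hausdorff_null.

(** * Entropy of finite partitions *)

Section fekete.
Context {R : realType}.
Variable a : nat -> R.
Hypothesis a_ge0 : forall n, 0 <= a n.
Hypothesis a_sub : forall m n, a (m + n)%N <= a m + a n.

(** Fekete's lemma, with the infimum of the quotients as limit. Convergence has to be known because
    [partition_entropy] is a bare [limn], which carries no information on a divergent sequence. *)
Lemma subadditive_cvg : cvgn (fun n => a n / n%:R).
Proof.
pose S := [set x : R | exists2 n, (0 < n)%N & x = a n / n%:R].
have S0 : has_inf S.
  split; first by exists (a 1%N / 1); exists 1%N.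
  by exists 0 => _ [n _ ->]; rewrite divr_ge0.
apply/cvg_ex; exists (inf S); apply/cvgrPdist_le => /= e e0.
have e20 : 0 < e / 2 by rewrite divr_gt0.
have [_ [m m0 ->] am] := inf_adherent e20 S0.
pose C := \sum_(r < m) a r.
have Cr (r : nat) : (r < m)%N -> a r <= C.
  move=> rm; rewrite /C (bigD1 (Ordinal rm))//= lerDl.
  by apply: sumr_ge0 => *; exact: a_ge0.
have amul q : a (q * m)%N <= q%:R * a m + a 0%N.
  elim: q => [|q IH]; first by rewrite mul0n mul0r add0r.
  rewrite mulSn (le_trans (a_sub _ _))// -natr1 mulrDl mul1r.
  by rewrite addrAC [leRHS]addrC lerD2l.
near=> n.
have n0 : 0 < n%:R :> R by rewrite ltr0n; near: n; exact: nbhs_infty_gt.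
have infn : inf S <= a n / n%:R.
  apply: ge_inf; first by case: S0.
  by exists n => //; rewrite -(ltr0n R).
rewrite ler0_norm ?subr_le0// opprB lerBlDr.
have nC : (a 0%N + C) / n%:R <= e / 2.
  rewrite ler_pdivrMr// -ler_pdivrMl//; near: n.
  exact: nbhs_infty_ger.
have an : a n <= n%:R * (a m / m%:R) + (a 0%N + C).
  rewrite {1}(divn_eq n m) (le_trans (a_sub _ _))// addrA.
  apply: lerD; last by apply: Cr; rewrite ltn_mod.
  rewrite (le_trans (amul _))// lerD2r mulrA mulrAC ler_wpM2r//.
  by rewrite ler_pdivlMr ?ltr0n// -natrM ler_nat leq_divM.
rewrite (le_trans (y := a m / m%:R + (a 0%N + C) / n%:R))//.
  by rewrite ler_pdivrMr// mulrDl mulfVK ?gt_eqF// mulrC.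
by rewrite (le_trans (lerD (ltW am) nC))//; lra.
Unshelve. all: by end_near. Qed.

Lemma subadditive_lim_lt (g : R) N : limn (fun n => a n / n%:R) < g ->
  exists2 n, (N <= n)%N & a n <= g * n%:R.
Proof.
move=> lg.
have [M _ MP] : \forall n \near \oo, a n / n%:R < g.
  exact: (cvgr_lt _ subadditive_cvg).
exists (maxn 1 (maxn N M)).
  by rewrite (leq_trans (leq_maxl N M))// leq_maxr.
set n := maxn _ _.
have n1 : (0 < n)%N by rewrite leq_maxl.
rewrite -ler_pdivrMr ?ltr0n//; apply/ltW/MP => /=.
by rewrite (leq_trans (leq_maxr N M))// leq_maxr.
Qed.

End fekete.

Section finite_partitions.
Context {d} {X : measurableType d} {R : realType}.

Definition finite_partition (I : finType) (P : I -> set X) :=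
  [/\ forall i, measurable (P i), trivIset setT P & \bigcup_i P i = setT].

Lemma fine_measure_partition (mu : {finite_measure set X -> \bar R})
    (I : finType) (P : I -> set X) (A : set X) :
  finite_partition P -> measurable A ->
  fine (mu A) = \sum_i fine (mu (A `&` P i)).
Proof.
move=> [mP tP cP] mA.
have finmu B : measurable B -> mu B \is a fin_num.
  by move=> mB; exact: fin_num_measure.
rewrite sum_fine; last by move=> i _; apply: finmu; exact: measurableI.
congr fine; rewrite -[in LHS](setIT A) -cP setI_bigcupr.
rewrite measure_fin_bigcup//; last 2 first.
- apply/trivIsetP => i j _ _ ij; rewrite setIACA.
  by move/trivIsetP : tP => /(_ i j) ->//; rewrite setI0.
- by move=> i _; exact: measurableI.
rewrite (fsbigE (enum I))//= ?enum_uniq//; last by move=> i _; rewrite mem_enum.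
by rewrite big_enum_cond/=; apply: eq_bigl => i; rewrite in_setT.
exact: finite_finset.
Qed.

Lemma finite_partition_preimage (I : finType) (P : I -> set X) (f : X -> X) :
  measurable_fun setT f -> finite_partition P ->
  finite_partition (fun i => f @^-1` P i).
Proof.
move=> mf [mP tP cP]; split.
- by move=> i; rewrite -[X in measurable X]setTI; exact: mf.
- move/trivIsetP : tP => tP; apply/trivIsetP => i j _ _ ij.
  by rewrite -preimage_setI tP// preimage_set0.
- by rewrite -preimage_bigcup cP preimage_setT.
Qed.

End finite_partitions.

Section static_entropy.
Context {d} {X : measurableType d} {R : realType}.
Variable mu : probability X R.

Lemma fine_mu_le1 A : measurable A -> fine (mu A) <= 1.
Proof.
move=> mA; rewrite -lee_fin fineK ?fin_num_measure//.
exact: probability_le1.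
Qed.

Lemma static_entropy_ge0 (I : finType) (P : I -> set X) :
  (forall i, measurable (P i)) -> 0 <= static_entropy mu P.
Proof.
move=> mP; rewrite /static_entropy -sumrN sumr_ge0// => i _.
rewrite -mulrN mulr_ge0 ?fine_ge0// oppr_ge0 ln_le0//.
exact: fine_mu_le1.
Qed.

(* Gibbs' inequality against the product of the marginals. *)
Lemma static_entropyX (I J : finType) (P : I -> set X) (Q : J -> set X) :
  finite_partition P -> finite_partition Q ->
  static_entropy mu (fun ij : I * J => P ij.1 `&` Q ij.2) <=
  static_entropy mu P + static_entropy mu Q.
Proof.
move=> pP pQ; have [mP _ _] := pP; have [mQ _ _] := pQ.
have fin1 : fine (mu setT) = 1 by rewrite probability_setT.
rewrite /static_entropy -opprD lerN2.
pose p i j := fine (mu (P i `&` Q j)).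
have aE i : fine (mu (P i)) = \sum_j p i j by exact: fine_measure_partition.
have bE j : fine (mu (Q j)) = \sum_i p i j.
  rewrite (fine_measure_partition mu pP)//.
  by apply: eq_bigr => i _; rewrite setIC.
have p0 i j : 0 <= p i j by exact: fine_ge0.
set a := fun i => fine (mu (P i)); set b := fun j => fine (mu (Q j)).
have pa i j : p i j <= a i by rewrite /a aE (bigD1 j)//= lerDl sumr_ge0.
have pb i j : p i j <= b j by rewrite /b bE (bigD1 i)//= lerDl sumr_ge0.
have suma : \sum_i a i = 1.
  rewrite -fin1 (fine_measure_partition mu pP)//.
  by apply: eq_bigr => i _; rewrite setTI.
have sumb : \sum_j b j = 1.
  rewrite -fin1 (fine_measure_partition mu pQ)//.
  by apply: eq_bigr => i _; rewrite setTI.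
have -> : \sum_i a i * ln (a i) = \sum_i \sum_j p i j * ln (a i).
  by apply: eq_bigr => i _; rewrite -mulr_suml -aE.
have -> : \sum_j b j * ln (b j) = \sum_i \sum_j p i j * ln (b j).
  by rewrite exchange_big/=; apply: eq_bigr => i _; rewrite -mulr_suml -bE.
rewrite -(pair_bigA _ (fun i j => p i j * ln (p i j)))/=.
have : \sum_i \sum_j (p i j - a i * b j) <=
    \sum_i \sum_j (p i j * ln (p i j) - (p i j * ln (a i) + p i j * ln (b j))).
  apply: ler_sum => i _; apply: ler_sum => j _.
  have [pij0|pij0] := eqVneq (p i j) 0.
    by rewrite pij0 !mul0r addr0 subr0 sub0r oppr_le0 mulr_ge0 ?fine_ge0.
  have pgt0 : 0 < p i j by rewrite lt_neqAle eq_sym pij0 p0.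
  have agt0 : 0 < a i by exact: lt_le_trans (pa i j).
  have bgt0 : 0 < b j by exact: lt_le_trans (pb i j).
  rewrite -mulrDr -mulrBr -{1}(mulr1 (p i j)).
  have -> : p i j * 1 - a i * b j = p i j * (1 - a i * b j / p i j).
    by field; lra.
  rewrite ler_wpM2l// -lnM ?posrE// -lerN2 !opprB -ln_div ?posrE ?mulr_gt0//.
  have := @le_ln1Dx R (a i * b j / p i j - 1).
  rewrite [1 + _]addrC subrK; apply.
  by rewrite ltrBrDl subrr divr_gt0// mulr_gt0.
have -> : \sum_i \sum_j (p i j - a i * b j) = 0.
  transitivity (\sum_i (a i - a i)); last by rewrite sumrB subrr.
  by apply: eq_bigr => i _; rewrite sumrB -mulr_sumr sumb mulr1 -aE.
have -> : \sum_i \sum_j (p i j * ln (p i j) -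
      (p i j * ln (a i) + p i j * ln (b j))) =
    \sum_i \sum_j p i j * ln (p i j) -
      (\sum_i \sum_j p i j * ln (a i) + \sum_i \sum_j p i j * ln (b j)).
  rewrite -big_split/= -sumrB; apply: eq_bigr => i _.
  by rewrite -big_split/= -sumrB.
by rewrite subr_ge0.
Qed.

End static_entropy.

Section words.
Variables (T : Type) (m n : nat).

Definition word_cat (uv : {ffun 'I_m -> T} * {ffun 'I_n -> T}) :
    {ffun 'I_(m + n) -> T} :=
  [ffun i => match fintype.split i with inl j => uv.1 j | inr j => uv.2 j end].

Lemma word_cat_bij : bijective word_cat.
Proof.
exists (fun w : {ffun _ -> T} => ([ffun i => w (lshift n i)], [ffun j =>
  w (rshift m j)])).
- move=> [u v]; congr pair; apply/ffunP => i; rewrite !ffunE.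
  + by rewrite (unsplitK (inl i)).
  + by rewrite (unsplitK (inr i)).
- move=> w; apply/ffunP => i; rewrite ffunE.
  by rewrite -[in RHS](splitK i); case: fintype.split => j /=; rewrite ffunE.
Qed.

End words.

Section iterates.
Context {d} {X : measurableType d} {R : realType}.
Variables (mu : {measure set X -> \bar R}) (f : X -> X).
Hypothesis mf : measurable_fun setT f.
Hypothesis f_mu : forall E, measurable E -> mu (f @^-1` E) = mu E.

Lemma measurable_iter n : measurable_fun setT (iter n f).
Proof.
elim: n => [|n IH]; first exact: measurable_id.
rewrite (_ : iter n.+1 f = f \o iter n f)//.
exact: measurableT_comp.
Qed.

Lemma measure_iter n E : measurable E -> mu (iter n f @^-1` E) = mu E.
Proof.
elim: n E => [//|n IH] E mE.
rewrite (_ : _ @^-1` E = iter n f @^-1` (f @^-1` E))// IH ?f_mu//.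
by rewrite -[X in measurable X]setTI; exact: mf.
Qed.

End iterates.

Section entropy.
Context {d} {X : measurableType d} {R : realType}.
Variables (mu : probability X R) (f : X -> X) (k : nat) (P : 'I_k -> set X).
Hypothesis mf : measurable_fun setT f.
Hypothesis f_mu : forall E, measurable E -> mu (f @^-1` E) = mu E.
Hypothesis mP : measurable_partition P.

Lemma itinerary_atom_cat m n (uv : {ffun 'I_m -> 'I_k} * {ffun 'I_n -> 'I_k}) :
  itinerary_atom f P (word_cat uv) =
  itinerary_atom f P uv.1 `&` iter m f @^-1` itinerary_atom f P uv.2.
Proof.
case: uv => u v; apply/seteqP; split=> x /=.
- move=> Pw; split=> i.
    by have := Pw (lshift n i); rewrite ffunE (unsplitK (inl i)).
  have := Pw (rshift m i); rewrite ffunE (unsplitK (inr i))/=.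
  by rewrite addnC iterD.
- move=> [Pu Pv] i; rewrite ffunE -{2}(splitK i); case: fintype.split => j /=.
    exact: Pu.
  by rewrite addnC iterD; exact: Pv.
Qed.

Lemma itinerary_atom_partition n :
  finite_partition (@itinerary_atom _ X f k P n).
Proof.
have [mP' tP cP] := mP; split.
- move=> w; rewrite (_ : itinerary_atom _ _ _ =
    \bigcap_(i in [set: 'I_n]) iter i f @^-1` P (w i)); last first.
    by apply/seteqP; split=> x /= Px i; [move=> _|]; exact: Px.
  apply: fin_bigcap_measurable => // i _.
  by rewrite -[X in measurable X]setTI; exact: measurable_iter.
- apply/trivIsetP => u v _ _ uv; apply/seteqP; split=> // x [Pu Pv].
  move/eqP : uv; apply; apply/ffunP => i; apply/eqP/negPn/negP => uvi.
  move/trivIsetP : tP => /(_ _ _ Logic.I Logic.I uvi).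
  by move/seteqP => [+ _] => /(_ (iter i f x)); apply; split;
    [exact: Pu|exact: Pv].
- apply/seteqP; split=> // x _.
  have Px y : exists i, P i y.
    suff : (\bigcup_i P i) y by case=> i _ Pi; exists i.
    by rewrite cP.
  have [s sP] := choice Px.
  by exists [ffun i : 'I_n => s (iter i f x)] => // i; rewrite ffunE.
Qed.

(** An atom of length m + n is an atom of length m intersected with the preimage under the m-th
    iterate of one of length n; invariance removes the preimage from the entropy, and
    [static_entropyX] applies. *)
Lemma static_entropy_subadditive m n :
  static_entropy mu (@itinerary_atom _ X f k P (m + n)) <=
  static_entropy mu (@itinerary_atom _ X f k P m) +
  static_entropy mu (@itinerary_atom _ X f k P n).
Proof.
have pm := itinerary_atom_partition m; have pn := itinerary_atom_partition n.
have [mn _ _] := pn.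
have -> : static_entropy mu (@itinerary_atom _ X f k P n) =
    static_entropy mu (fun v => iter m f @^-1` (@itinerary_atom _ X f k P n v)).
  by congr (- _); apply: eq_bigr => v _; rewrite measure_iter.
apply: le_trans (static_entropyX mu pm (finite_partition_preimage _ pn)) => //.
  rewrite /static_entropy (reindex _ (onW_bij _ (word_cat_bij _ m n)))/=.
  by under eq_bigr do rewrite itinerary_atom_cat.
exact: measurable_iter.
Qed.

(** Entropy is used only through this: one word length, as large as desired so that additive
    constants of the code become negligible against g n. *)
Lemma ks_entropy_lt (g : R) N : (ks_entropy mu f < g%:E)%E ->
  exists2 n, (N <= n)%N &
    static_entropy mu (@itinerary_atom _ X f k P n) <= g * n%:R.
Proof.
move=> hg; apply: (@subadditive_lim_lt R).
- move=> n; apply: static_entropy_ge0.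
  by have [] := itinerary_atom_partition n.
- exact: static_entropy_subadditive.
- rewrite -lte_fin (le_lt_trans _ hg)//; apply: ereal_sup_ubound.
  by exists k, P.
Qed.

End entropy.

(** * Matrix norms *)

Section matrix_norm.
Context {R : realType}.
Implicit Types (m n p : nat).

Lemma mx_norm_entry m n (A : 'M[R]_(m, n)) i j : `|A i j| <= `|A|.
Proof. by rewrite /Num.Def.normr /= mx_normrE (le_bigmax _ _ (i, j)). Qed.

Lemma mx_norm_le m n (A : 'M[R]_(m, n)) (c : R) : 0 <= c ->
  (forall i j, `|A i j| <= c) -> `|A| <= c.
Proof.
by move=> c0 Ac; rewrite /Num.Def.normr /= mx_normrE; apply/bigmax_leP;
  split=> // -[].
Qed.

Lemma mx_norm_mul m n p (A : 'M[R]_(m, n)) (B : 'M[R]_(n, p)) :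
  `|A *m B| <= n%:R * `|A| * `|B|.
Proof.
apply: mx_norm_le => [|i j]; first by rewrite !mulr_ge0.
rewrite mxE (le_trans (ler_norm_sum _ _ _))//.
rewrite (le_trans (y := \sum_(k < n) (`|A| * `|B|)))//.
  by apply: ler_sum => k _; rewrite normrM ler_pM// mx_norm_entry.
by rewrite sumr_const card_ord -[leLHS]mulr_natl mulrA.
Qed.

(** For determinant 1 the inverse is the adjugate, whose entries are up to sign 2 x 2 minors, each
    made of two products of entries. *)
Lemma mx_norm_inv (A : 'M[R]_3) : \det A = 1 -> `|invmx A| <= 2 * `|A| ^+ 2.
Proof.
move=> detA; have uA : A \in unitmx by rewrite unitmxE detA unitr1.
rewrite /invmx uA detA invr1 scale1r.
apply: mx_norm_le => [|i j]; first by rewrite mulr_ge0// exprn_ge0.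
rewrite mxE /cofactor normrM normrX normrN1 expr1n mul1r.
rewrite (expand_det_row _ ord0) !big_ord_recl big_ord0 addr0 /cofactor
  !det_mx11.
rewrite !mxE mulr2n mulrDl mul1r (le_trans (ler_normD _ _))//.
by apply: lerD; rewrite !normrM normrX normrN1 expr1n mul1r expr2 ler_pM//
  mx_norm_entry.
Qed.

Lemma compact_mx_le (N : R) : compact [set A : 'M[R]_3 | `|A| <= N].
Proof.
pose f (v : 'rV[R]_(3 * 3)) : 'M[R]_3 := vec_mx v.
have cf : continuous f.
  move=> v; apply: mx_cvg => i j; rewrite /f.
  under eq_fun do rewrite mxE; rewrite mxE.
  exact: coord_continuous.
rewrite (_ : mkset _ = f @` [set v | `|v| <= N]).
  apply: continuous_compact; first exact: continuous_subspaceT.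
  apply: bounded_closed_compact.
    by exists N; split; [exact: num_real|move=> M NM v /= /le_trans; apply;
      exact: ltW].
  rewrite (_ : mkset _ = (fun v : 'rV[R]_(3 * 3) =>
    `|v|) @^-1` [set x | x <= N])//.
  by apply: closed_comp; [move=> v _; exact: norm_continuous|exact: closed_le].
apply/seteqP; split=> [A /= AN|_ [v /= vN] <-].
  have N0 : 0 <= N by rewrite (le_trans _ AN).
  exists (mxvec A); last by rewrite /f mxvecK.
  apply: mx_norm_le => // i j; rewrite ord1; case/mxvec_indexP: j => i' j'.
  by rewrite mxvecE (le_trans (mx_norm_entry _ _ _)).
have N0 : 0 <= N by rewrite (le_trans _ vN).
by apply: mx_norm_le => // i j; rewrite mxE (le_trans (mx_norm_entry _ _ _)).
Qed.

Lemma continuous_mulmxl (A : 'M[R]_3) : continuous (fun B : 'M[R]_3 => A *m B).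
Proof.
suff cij i j : continuous (fun B : 'M[R]_3 => \sum_k A i k * B k j).
  move=> B; apply: mx_cvg => i j; rewrite mxE; under eq_fun do rewrite mxE.
  exact: cij.
apply: continuous_big => [|k _ B]; first exact: add_continuous.
apply: continuousM; [exact: cst_continuous|exact: coord_continuous].
Qed.

Lemma continuous_det : continuous (fun A : 'M[R]_3 => \det A).
Proof.
rewrite /determinant; apply: continuous_big => [|s _];
  first exact: add_continuous.
move=> A; apply: (@continuousM _ _ (fun=> (-1) ^+ s)
  (fun A : 'M[R]_3 => \prod_i A i (s i)) A); first exact: cst_continuous.
move: A; apply: continuous_big => [|i _]; first exact: mul_continuous.
exact: coord_continuous.
Qed.

(** Entries are rounded down to a grid of step N / L. The net consists of arbitrary matrices rather
    than elements of [SL3]: later estimates see only their norm. *)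
Lemma mx_net (N r : R) : 0 <= N -> 0 < r ->
  exists k (h : 'I_k -> 'M[R]_3), (forall i, `|h i| <= N) /\
    forall A, `|A| <= N -> exists i, `|A - h i| < r.
Proof.
move=> N0 r0.
pose L := (Num.truncn (2 * N / r)).+1.
have L0 : 0 < L%:R :> R by rewrite ltr0n.
have NL : N / L%:R < r.
  rewrite ltr_pdivrMr// mulrC -ltr_pdivrMr//.
  rewrite (le_lt_trans (y := 2 * N / r))//.
    by rewrite ler_wpM2r ?invr_ge0 ?(ltW r0)//; lra.
  by rewrite truncnS_gt.
pose f (E : 'M['I_(2 * L).+1]_3) : 'M[R]_3 :=
  \matrix_(i, j) (((E i j : nat)%:R - L%:R) * (N / L%:R)).
exists #|'M['I_(2 * L).+1]_3|, (fun i => f (enum_val i)); split.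
  move=> e; apply: mx_norm_le => // i j; rewrite mxE normrM.
  rewrite (ger0_norm (x := N / _)) ?divr_ge0// mulrA ler_pdivrMr// mulrC.
  rewrite ler_wpM2l// ler_norml; apply/andP; split.
    by rewrite -subr_ge0 opprK subrK.
  rewrite lerBlDr -natrD addnn -mul2n ler_nat.
  by rewrite -ltnS ltn_ord.
move=> A AN.
suff [E AE] : exists E, `|A - f E| < r.
  by exists (enum_rank E); rewrite enum_rankK.
have P i j : exists e : 'I_(2 * L).+1, `|A i j - (e%:R - L%:R) * (N / L%:R)| <=
  N / L%:R.
  have [N00|N00] := eqVneq N 0.
    exists ord0; rewrite N00 mul0r mulr0 subr0 -N00.
    exact: le_trans (mx_norm_entry _ _ _) AN.
  have Ngt0 : 0 < N by rewrite lt_neqAle eq_sym N00.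
  have := le_trans (mx_norm_entry A i j) AN; rewrite ler_norml => /andP[NA AN'].
  pose y := (A i j + N) / (N / L%:R).
  have NL0 : 0 < N / L%:R by rewrite divr_gt0.
  have y0 : 0 <= y by rewrite divr_ge0 ?(ltW NL0)//; lra.
  have yL : (Num.truncn y < (2 * L).+1)%N.
    rewrite ltnS -(ler_nat R) (le_trans (y := y)) ?truncn_le//.
    rewrite /y ler_pdivrMr// natrM.
    have -> : 2 * L%:R * (N / L%:R) = 2 * N by field; lra.
    by lra.
  exists (Ordinal yL) => /=.
  have AE : A i j = (y - L%:R) * (N / L%:R).
    by rewrite /y mulrBl mulfVK ?gt_eqF// mulrCA divff ?gt_eqF// mulr1 addrK.
  rewrite AE -mulrBl opprB addrA subrK normrM (gtr0_norm NL0).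
  rewrite -[leRHS]mul1r ler_wpM2r ?ltW//.
  have /andP[ty yt] := truncn_itv y0.
  by rewrite -natr1 in yt; rewrite ger0_norm ?subr_ge0//; lra.
have [e eP] := choice (fun ij : 'I_3 * 'I_3 => P ij.1 ij.2).
exists (\matrix_(i, j) e (i, j)); rewrite (le_lt_trans _ NL)//.
apply: mx_norm_le => [|i j]; first by rewrite divr_ge0.
by rewrite !mxE; exact: (eP (i, j)).
Qed.

End matrix_norm.

(** * Distance to an orbit of lattice bases *)

Section orbit_distance.
Context {R : realType}.
Local Notation X := (quot_space R).
Implicit Types (g k : SL3 R) (h : 'M[R]_3) (x : X).

(** The distance from [h], not necessarily of determinant 1, to the bases of the lattice x; its
    sublevel sets serve as balls of X. For h = 0 it is the least norm of a basis, which measures how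
    far x lies in the cusp. *)
Definition orbit_dist h x : R :=
  inf [set `|mx_of g - h| | g in [set g | quot_proj g = x]].

Lemma has_inf_orbit_dist h x :
  has_inf [set `|mx_of g - h| | g in [set g : SL3 R | quot_proj g = x]].
Proof.
split; last by exists 0 => _ [g _ <-].
by exists `|mx_of (repr x) - h|, (repr x) => //=; exact: reprK.
Qed.

Lemma orbit_dist_le h g : orbit_dist h (quot_proj g) <= `|mx_of g - h|.
Proof. by apply: ge_inf; [have [] :=
  has_inf_orbit_dist h (quot_proj g)|exists g]. Qed.

Lemma orbit_dist_ltP h x (r : R) :
  orbit_dist h x < r <-> exists2 g, quot_proj g = x & `|mx_of g - h| < r.
Proof.
split=> [xr|[g <- gr]]; last exact: le_lt_trans (orbit_dist_le _ _) gr.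
have e0 : 0 < r - orbit_dist h x by rewrite subr_gt0.
have [_ [g gx <-]] := inf_adherent e0 (has_inf_orbit_dist h x).
by rewrite -/(orbit_dist h x) [_ + (r - _)]addrC subrK => gr; exists g.
Qed.

(** A nearly optimal basis k = g c of the first lattice gives the basis g' c of the second, and g' c
    - h = (k - h) + (g' - g) g^-1 k. The two products contribute a factor 3 each and the inverse 2
    B^2, whence 18; the last factor bounds the norm of k. *)
Lemma orbit_dist_lipschitz h g g' (B : R) :
  `|mx_of g| <= B -> `|mx_of g'| <= B ->
  orbit_dist h (quot_proj g') <= orbit_dist h (quot_proj g) +
    18 * `|mx_of g' - mx_of g| * B ^+ 2 * (B + 1 + 2 * `|h|).
Proof.
move=> gB g'B; apply/ler_addgt0Pr => e e0.
have B0 : 0 <= B by exact: le_trans gB.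
have : orbit_dist h (quot_proj g) < orbit_dist h (quot_proj g) + Num.min e 1.
  by rewrite ltrDl lt_min e0 ltr01.
move=> /orbit_dist_ltP[k /quot_projP].
move=> /SL3ZV; rewrite invgM invgK; set c := (g^-1 * k)%g => cZ kh.
have {}cZ : quot_proj (g' * c)%g = quot_proj g'.
  by apply/quot_projP; rewrite invgM -mulgA mulVg mulg1; exact: SL3ZV.
rewrite -cZ (le_trans (orbit_dist_le _ _))//.
have -> : mx_of (g' * c)%g - h = (mx_of k - h) +
    (mx_of g' - mx_of g) *m invmx (mx_of g) *m mx_of k.
  rewrite -mulmxA mulmxBl mulKVmx ?mx_of_unit// [RHS]addrC [RHS]addrA subrK.
  by [].
rewrite (le_trans (ler_normD _ _))// -addrA [X in _ <= _ + X]addrC addrA.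
apply: lerD.
  rewrite (le_trans (ltW kh))// lerD2l ge_min lexx//.
rewrite (le_trans (mx_norm_mul _ _))//.
have kB : `|mx_of k| <= B + 1 + 2 * `|h|.
  rewrite -[mx_of k](subrK h) (le_trans (ler_normD _ _))//.
  have := orbit_dist_le h g; have := ler_normB (mx_of g) h.
  have : Num.min e 1 <= 1 by rewrite ge_min lexx orbT.
  by move: kh gB; lra.
apply: ler_pM => //.
have := mx_norm_mul (mx_of g' - mx_of g) (invmx (mx_of g)).
have := mx_norm_inv (det_mx_of g).
have gB2 : `|mx_of g| ^+ 2 <= B ^+ 2 by rewrite lerXn2r ?nnegrE.
move=> gi gi2; rewrite (le_trans (ler_wpM2l _ gi2))//.
have : `|mx_of g' - mx_of g| * `|invmx (mx_of g)| <=
    `|mx_of g' - mx_of g| * (2 * B ^+ 2).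
  by rewrite ler_wpM2l// (le_trans gi)// ler_wpM2l.
by lra.
Qed.

Lemma continuous_mx_of : continuous (@mx_of R).
Proof. exact: initial_continuous. Qed.

Lemma continuous_orbit_dist h : continuous (orbit_dist h).
Proof.
suff cF : continuous (fun g : SL3 R => orbit_dist h (quot_proj g)).
  exact/quotient_continuous.
move=> g0; apply: (@cvgrPdist_le _ _ _ (nbhs g0) _ _ _).2 => /= e e0.
pose B := `|mx_of g0| + 1.
pose C := 18 * B ^+ 2 * (B + 1 + 2 * `|h|).
have C0 : 0 < C + 1.
  by rewrite ltr_wpDl// !mulr_ge0// ?exprn_ge0// !addr_ge0// mulr_ge0.
have d0 : 0 < Num.min 1 (e / (C + 1)) by rewrite lt_min ltr01 divr_gt0.
have cmx := @continuous_mx_of g0.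
near=> g.
have : `|mx_of g0 - mx_of g| < Num.min 1 (e / (C + 1)).
  near: g.
  exact: (@cvgr_dist_lt _ _ _ (nbhs g0) _ _ _ cmx).
rewrite lt_min => /andP[g1 ge].
have g0B : `|mx_of g0| <= B by rewrite lerDl.
have gB : `|mx_of g| <= B.
  rewrite -[mx_of g](subrK (mx_of g0)) (le_trans (ler_normD _ _))//.
  by rewrite addrC lerD2l distrC ltW.
have H1 := orbit_dist_lipschitz h g0B gB.
have H2 := orbit_dist_lipschitz h gB g0B.
have H : `|mx_of g0 - mx_of g| * C <= e.
  rewrite ltr_pdivlMr// in ge; apply: le_trans (ltW ge).
  by rewrite ler_wpM2l// lerDl.
rewrite [`|mx_of g - _|]distrC in H1.
have E : 18 * `|mx_of g0 - mx_of g| * B ^+ 2 * (B + 1 + 2 * `|h|) =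
  `|mx_of g0 - mx_of g| * C by rewrite /C; ring.
rewrite E in H1 H2; rewrite ler_distl /=.
by apply/andP; split; [rewrite lerBlDr|];
  [apply: le_trans H1 _|apply: le_trans H2 _]; rewrite lerD2l.
Unshelve. all: by end_near. Qed.

(** The topology is induced from matrices, so a cluster point of the image filter is enough; it has
    determinant 1 because that condition is closed. *)
Lemma compact_SL3_le (N : R) : compact [set g : SL3 R | `|mx_of g| <= N].
Proof.
move=> F FF FN.
have [m [/= mN cm]] := compact_mx_le (F := @mx_of R @ F) _ FN.
have m1 : \det m = 1.
  have cl : closed [set A : 'M[R]_3 | \det A = 1].
    rewrite (_ : mkset _ = (fun A : 'M[R]_3 => \det A) @^-1` [set 1])//.
    apply: closed_comp; last exact: closed_eq.
    by move=> A _; exact: continuous_det.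
  apply: cl => B mB; apply: cm => //.
  by apply: (filterS (F := F)) (filterT (F := F)) => g _ /=; exact: det_mx_of.
pose g := MkSL3 (introT eqP m1).
exists g; split=> // A B FA [_ [[W oW <-] Wg WB]].
have [_ [[k Ak <-] Wk]] : (@mx_of R @` A) `&` W !=set0.
  apply: cm; last exact: open_nbhs_nbhs.
  by apply: (filterS (F := F)) FA => k Ak; exists k.
by exists k; split=> //; exact: WB.
Qed.

Lemma compact_quot_le (N : R) :
  compact (@quot_proj R @` [set g : SL3 R | `|mx_of g| <= N]).
Proof.
apply: continuous_compact (@compact_SL3_le N).
by apply: continuous_subspaceT; exact: pi_continuous.
Qed.

Lemma continuous_quot_act g : continuous (quot_act g).
Proof.
apply/quotient_continuous.
rewrite (_ : _ \o _ = @quot_proj R \o (fun k => g * k)%g); last first.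
  by apply/funext => k /=; rewrite -quot_act_proj.
have cg : continuous (fun k : SL3 R => (g * k)%g : SL3 R).
  apply: continuous_comp_initial => k.
  apply: (continuous_comp (@continuous_mx_of k)).
  exact: continuous_mulmxl.
by move=> k; apply: (continuous_comp (cg k)); exact: pi_continuous.
Qed.

Lemma measurable_continuous_quot (f : X -> R) :
  continuous f -> measurable_fun setT f.
Proof.
move=> /continuousP cf.
apply: (measurability (@measurable_realfun.RGenOInfty.G R)).
  exact: measurable_realfun.RGenOInfty.measurableE.
move=> _ [_ [a ->] <-]; rewrite setTI; apply: sub_sigma_algebra.
by apply: cf; exact: rray_open.
Qed.

Lemma measurable_orbit_dist h : measurable_fun setT (orbit_dist h).
Proof. by apply: measurable_continuous_quot; exact: continuous_orbit_dist. Qed.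

Lemma measurable_quot_act g : measurable_fun setT (quot_act g : X -> X).
Proof.
apply: (@measurability _ _ _ _ _ _ (@open X)) => //.
move=> _ [V oV <-]; rewrite setTI; apply: sub_sigma_algebra.
by move/continuousP : (@continuous_quot_act g); exact.
Qed.

Lemma mx_int_eq1 (A : 'M[R]_3) : (forall i j, A i j \is a Num.int) ->
  `|A - 1%:M| < 1 -> A = 1%:M.
Proof.
move=> AZ A1; apply/matrixP => i j; apply/eqP; rewrite -subr_eq0.
have : `|A i j - (1%:M : 'M[R]_3) i j| < 1.
  by apply: le_lt_trans A1; have := mx_norm_entry (A - 1%:M) i j; rewrite !mxE.
rewrite mxE; have : (A i j - (i == j)%:R) \is a Num.int by rewrite rpredB ?AZ
  ?rpred_nat.
move=> /intrP[z ->]; rewrite -intr_norm -[ltRHS]/(1%:~R) ltr_int.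
by rewrite intr_eq0 => z1; lia.
Qed.

(* The integral matrix gam = g'^-1 v g is close to the identity, hence equal to
   it, so that v = g' g^-1 and v - 1 is controlled by r alone. *)
Lemma return_rigidity (N c : R) : 0 < N -> 0 < c ->
  exists r rho : R, [/\ 0 < r, 0 < rho &
    forall (h v : 'M[R]_3) (g g' gam : SL3 R), `|h| <= N -> SL3Z gam ->
      `|mx_of g - h| <= r -> `|mx_of g' - h| <= r ->
      v *m mx_of g = mx_of g' *m mx_of gam ->
      `|v - 1%:M| <= rho -> `|v - 1%:M| <= c * rho].
Proof.
move=> N0 c0.
pose B := N + 1; have B0 : 0 < B by rewrite addr_gt0.
(* [D] bounds 3 |g^-1| when |g| <= B. With rho = 2 D r / c, the norm of gam - 1 is at most r D E,
   made less than 1 by the choice of [r]; the final bound on v - 1 is 2 r D, which is c rho. *)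
pose D := 6 * B ^+ 2; have D0 : 0 < D by rewrite mulr_gt0// exprn_gt0.
pose E := 3 * (2 * D / c) * B + 2.
have E0 : 0 < E by rewrite ltr_wpDl// !mulr_ge0 ?invr_ge0// ltW.
pose r := Num.min 1 (D * E + 1)^-1.
have DE0 : 0 < D * E + 1 by rewrite ltr_wpDl// mulr_ge0 ?ltW.
have r0 : 0 < r by rewrite lt_min ltr01 invr_gt0.
have rDE : r * (D * E) < 1.
  rewrite (@le_lt_trans _ _ ((D * E + 1)^-1 * (D * E)))//.
    by rewrite ler_wpM2r ?(ltW (mulr_gt0 D0 E0))// /r ge_min lexx orbT.
  by rewrite mulrC ltr_pdivrMr// mul1r ltrDl.
have rho0 : 0 < 2 * D / c * r by rewrite !mulr_gt0 ?invr_gt0.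
exists r, (2 * D / c * r); split=> // h v g g' gam hN gamZ gh g'h vg v1.
have nB k : `|mx_of k - h| <= r -> `|mx_of k| <= B.
  move=> kh; rewrite -[mx_of k](subrK h) (le_trans (ler_normD _ _))//.
  by rewrite addrC lerD// (le_trans kh)// ge_min lexx.
have nI k : `|mx_of k - h| <= r -> 3 * `|invmx (mx_of k)| <= D.
  move=> /nB kB; rewrite /D (_ : 6 * _ = 3 * (2 * B ^+ 2)); last by ring.
  rewrite ler_wpM2l// (le_trans (mx_norm_inv (det_mx_of _)))//.
  by rewrite ler_wpM2l// lerXn2r ?nnegrE// ltW.
have gg' : `|mx_of g - mx_of g'| <= 2 * r.
  rewrite (_ : _ - _ = (mx_of g - h) - (mx_of g' - h)); last first.
    by rewrite opprB addrA subrK.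
  by rewrite (le_trans (ler_normB _ _))//; lra.
have gam1 : mx_of gam = 1%:M.
  apply: mx_int_eq1 => //.
  have -> : mx_of gam - 1%:M =
      invmx (mx_of g') *m ((v - 1%:M) *m mx_of g + (mx_of g - mx_of g')).
    rewrite mulmxBl vg mul1mx addrA subrK mulmxBr mulKmx ?mx_of_unit//.
    by rewrite mulVmx ?mx_of_unit.
  rewrite (le_lt_trans (mx_norm_mul _ _))// (le_lt_trans _ rDE)//.
  rewrite [leRHS]mulrCA ler_pM ?nI// (le_trans (ler_normD _ _))//.
  rewrite /E mulrDr; apply: lerD; last by rewrite mulrC.
  rewrite (le_trans (mx_norm_mul _ _))//.
  rewrite (le_trans (ler_pM _ _ (ler_wpM2l _ v1) (nB _ gh)))//.
  by rewrite le_eqVlt; apply/orP; left; apply/eqP; ring.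
have -> : v - 1%:M = (mx_of g' - mx_of g) *m invmx (mx_of g).
  rewrite mulmxBl mulmxV ?mx_of_unit//; congr (_ - _).
  by rewrite -[mx_of g']mulmx1 -gam1 -vg mulmxK// mx_of_unit.
rewrite (le_trans (mx_norm_mul _ _))// mulrAC mulrC.
rewrite (_ : c * _ = 2 * r * D); last by field; lra.
by rewrite ler_pM// ?nI// distrC.
Qed.

End orbit_distance.

(** * The diagonal flow and the horospherical group *)

Section diagonal_action.
Context {R : realType}.
Local Notation X := (quot_space R).

Lemma a_eltD (s t s' t' : R) :
  (a_elt s t * a_elt s' t')%g = a_elt (s + s') (t + t').
Proof.
apply: val_inj => /=; apply/matrixP => i j.
rewrite /a_mx mul_diag_mx !mxE mulrnAr; congr (_ *+ _).
by case: i => -[|[|[|//]]] i3 /=; rewrite -expRD; congr expR; lra.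
Qed.

Lemma quot_act_aD (s t s' t' : R) (x : X) :
  quot_act (a_elt s t) (quot_act (a_elt s' t') x) =
  quot_act (a_elt (s + s') (t + t')) x.
Proof. by rewrite -quot_actM a_eltD. Qed.

Lemma iter_quot_act n (x : X) :
  iter n (quot_act (a_elt 1 0)) x = quot_act (a_elt n%:R 0) x.
Proof.
elim: n => [|n IH]; last by rewrite iterS IH quot_act_aD addr0 -nat1r.
have -> : a_elt 0 0 = 1%g :> SL3 R.
  apply: val_inj => /=; rewrite /a_mx -diag_const_mx; congr diag_mx.
  apply/rowP => i; rewrite !mxE.
  by case: i => -[|[|[|//]]] i3 /=; rewrite ?oppr0 ?addr0 expR0.
by rewrite quot_act1.
Qed.

Definition unipotent (p q : R) : 'M[R]_3 :=
  1%:M + p *: delta_mx 1 0 + q *: delta_mx 2 0.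

Lemma horoE (u : horo R) : mx_of u = unipotent (mx_of u 1 0) (mx_of u 2 0).
Proof.
have /set_mem[u1 [u2 /= uE]] := valP u; rewrite uE !mxE/=.
by rewrite !mulr1n !mulr0n !add0r !mulr1 !mulr0 !addr0 !add0r.
Qed.

(** Conjugation by [a_mx s t] expands the two coordinates of U by the ratios of diagonal entries e^s
    / e^(-s-t) and e^t / e^(-s-t). *)
Lemma unipotent_conj (s t p q p' q' : R) :
  unipotent (expR (2 * s + t) * (p' - p)) (expR (s + 2 * t) * (q' - q)) *m
    (a_mx s t *m unipotent p q) = a_mx s t *m unipotent p' q'.
Proof.
have e1 : expR s = expR (2 * s + t) * expR (- s - t).
  by rewrite -expRD; congr expR; lra.
have e2 : expR t = expR (s + 2 * t) * expR (- s - t).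
  by rewrite -expRD; congr expR; lra.
apply/matrixP => i j; rewrite /a_mx !mul_diag_mx !mxE.
rewrite !big_ord_recl big_ord0 !mxE.
case: i => -[|[|[|//]]] i3; case: j => -[|[|[|//]]] j3;
  rewrite /= ?(mulr1n, mulr0n, mulr1, mulr0, addr0, add0r, mul0r, mul1r) //=.
all: by rewrite ?e1 ?e2; ring.
Qed.

Lemma unipotent_norm (p q r : R) : 0 <= r ->
  (`|unipotent p q - 1%:M| <= r) = (`|p| <= r) && (`|q| <= r).
Proof.
move=> r0; have -> : unipotent p q - 1%:M = p *: delta_mx 1 0 + q *: delta_mx 2
  0.
  by rewrite /unipotent -[X in X - _]addrA addrAC subrr add0r.
apply/idP/andP => [H|[pr qr]].
  split; apply: le_trans H.
    have := mx_norm_entry (p *: delta_mx 1 0 + q *: delta_mx 2 0 : 'M[R]_3) 1 0.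
    by rewrite !mxE/= !mulr1 !mulr0 addr0.
  have := mx_norm_entry (p *: delta_mx 1 0 + q *: delta_mx 2 0 : 'M[R]_3) 2 0.
  by rewrite !mxE/= !mulr1 !mulr0 add0r.
apply: mx_norm_le => // i j; rewrite !mxE.
case: i => -[|[|[|//]]] i3; case: j => -[|[|[|//]]] j3;
  by rewrite /= ?(mulr1, mulr0, addr0, add0r, normr0).
Qed.

(** Bases g and g' close to [h] differ from a u k and a v k by integral matrices [cu] and [cv],
    where k represents x. The expanded displacement V from u to v then satisfies V g = g' (cv^-1
    cu), the situation of [return_rigidity]. *)
Lemma horo_rigidity (N c : R) : 0 < N -> 0 < c ->
  exists r rho : R, [/\ 0 < r, 0 < rho &
    forall (h : 'M[R]_3) (x : X) (s t : R) (u v : horo R), `|h| <= N ->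
      orbit_dist h (quot_act (a_elt s t) (quot_act u x)) < r ->
      orbit_dist h (quot_act (a_elt s t) (quot_act v x)) < r ->
      expR (2 * s + t) * `|mx_of v 1 0 - mx_of u 1 0| <= rho ->
      expR (s + 2 * t) * `|mx_of v 2 0 - mx_of u 2 0| <= rho ->
      expR (2 * s + t) * `|mx_of v 1 0 - mx_of u 1 0| <= c * rho /\
      expR (s + 2 * t) * `|mx_of v 2 0 - mx_of u 2 0| <= c * rho].
Proof.
move=> N0 c0; have [r [rho [r0 rho0 H]]] := return_rigidity N0 c0.
exists r, rho; split=> // h x s t u v hN.
move=> /orbit_dist_ltP[g gx gh] /orbit_dist_ltP[g' gx' gh'] v1 v2.
set V := unipotent (expR (2 * s + t) * (mx_of v 1 0 - mx_of u 1 0))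
  (expR (s + 2 * t) * (mx_of v 2 0 - mx_of u 2 0)).
have aV1 y z : `|expR y * z| = expR y * `|z| by rewrite normrM gtr0_norm
  ?expR_gt0.
have V1 : `|V - 1%:M| <= rho by rewrite unipotent_norm ?(ltW rho0)// !aV1 v1 v2.
suff : `|V - 1%:M| <= c * rho.
  by rewrite unipotent_norm ?(ltW (mulr_gt0 c0 rho0))// !aV1 => /andP[].
move: gx gx'; rewrite -!quot_actM /quot_act.
set k := repr x => /esym/quot_projP gk /esym/quot_projP gk'.
pose cu := ((a_elt s t * u * k)^-1 * g)%g.
pose cv := ((a_elt s t * v * k)^-1 * g')%g.
apply: (H h V g g' (cv^-1 * cu)%g hN _ (ltW gh) (ltW gh') _ V1).
  by apply: SL3ZM => //; exact: SL3ZV.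
have -> : mx_of g = (a_mx s t *m mx_of u) *m mx_of k *m mx_of cu.
  have -> : (a_mx s t *m mx_of u) *m mx_of k = mx_of (a_elt s t * u * k)%g by
    [].
  by rewrite -[RHS]/(mx_of (_ * _)%g) mulVKg.
have -> : mx_of g' *m mx_of (cv^-1 * cu)%g =
    (a_mx s t *m mx_of v) *m mx_of k *m mx_of cu.
  have -> : (a_mx s t *m mx_of v) *m mx_of k = mx_of (a_elt s t * v * k)%g by
    [].
  rewrite -[LHS]/(mx_of (_ * _)%g) -[RHS]/(mx_of (_ * _)%g); congr mx_of.
  by rewrite /cv invgM invgK !mulgA mulgV mul1g.
rewrite !mulmxA -(mulmxA V); congr (_ *m _ *m _).
have := unipotent_conj s t (mx_of u 1 0) (mx_of u 2 0) (mx_of v 1 0) (mx_of v 2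
  0).
by rewrite -!horoE => e; rewrite /V e.
Qed.

Lemma expR_near0 (e : R) : 0 < e ->
  exists2 d : R, 0 < d & forall x : R, `|x| <= d -> `|expR x - 1| <= e.
Proof.
move=> e0; have := @continuous_expR R 0; rewrite /continuous_at expR0.
move=> /cvgrPdist_le/(_ _ e0)/nbhs_ballP[d /= d0 dP].
exists (d / 2) => [|x xd]; first by rewrite divr_gt0.
rewrite distrC; apply: dP; rewrite /ball/= sub0r normrN.
by rewrite (le_lt_trans xd)// ltr_pdivrMr// ltr_pMr// ltr1n.
Qed.

(** A basis within r / 2 of [h] has norm at most N + r, so it moves by at most r / 2 once the three
    diagonal entries of [a_mx s t] are close enough to 1. The exponent - s - t may reach 2 / K,
    which is why 1 / K is kept below d / 2. *)
Lemma orbit_dist_thicken (N r : R) : 0 < N -> 0 < r ->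
  exists2 K : nat, (0 < K)%N & forall (s t : R) (h : 'M[R]_3) (x : X),
    `|s| <= K%:R^-1 -> `|t| <= K%:R^-1 -> `|h| <= N ->
    orbit_dist h x < r / 2 -> orbit_dist h (quot_act (a_elt s t) x) < r.
Proof.
move=> N0 r0; have e0 : 0 < r / 2 / (N + r) by rewrite !divr_gt0 ?addr_gt0.
have [d d0 dP] := expR_near0 e0.
exists (Num.truncn (2 / d)).+1 => // s t h x sK tK hN.
move=> /orbit_dist_ltP[g <- gh]; apply/orbit_dist_ltP.
exists (a_elt s t * g)%g; first by rewrite quot_act_proj.
have Kd : (Num.truncn (2 / d)).+1%:R^-1 <= d / 2.
  by rewrite -[leRHS]invf_div lef_pV2 ?posrE ?divr_gt0// ltW// truncnS_gt.
move: (_%:R^-1) => k in sK tK Kd.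
have gN : `|mx_of g| <= N + r.
  rewrite -[mx_of g](subrK h) (le_trans (ler_normD _ _))//; lra.
suff ag : `|a_mx s t *m mx_of g - mx_of g| <= r / 2.
  rewrite -[_ - h]/(a_mx s t *m mx_of g - h) -(subrKA (mx_of g)).
  rewrite (le_lt_trans (ler_normD _ _))// [ltRHS]splitr ler_ltD//.
apply: mx_norm_le => [|i j]; first by rewrite ltW// divr_gt0.
rewrite /a_mx mul_diag_mx !mxE.
have -> y : y * mx_of g i j - mx_of g i j = (y - 1) * mx_of g i j by rewrite
  mulrBl mul1r.
rewrite normrM (le_trans (ler_pM _ _ (_ : _ <= r / 2 / (N + r)) (le_trans
  (mx_norm_entry _ _ _) gN)))//.
  move: i => -[[|[|[|//]]] i3] /=; apply: dP; last 2 first.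
  - by apply: le_trans sK _; lra.
  - by apply: le_trans tK _; lra.
  - rewrite (le_trans (ler_normB _ _))// normrN; lra.
by rewrite divfK// gt_eqF// addr_gt0.
Qed.

End diagonal_action.

(** * Covers by rectangles *)

Section rectangle_covers.
Context {R : realType}.
Implicit Types (S : set (R * R)) (N a b : R).

Definition coverable S N a b := exists c : seq (R * R), (size c)%:R <= N /\
  forall p, S p -> exists2 q, q \in c &
    q.1 <= p.1 <= q.1 + a /\ q.2 <= p.2 <= q.2 + b.

Lemma coverable_sub S S' N N' a b a' b' : S' `<=` S -> N <= N' -> a <= a' ->
  b <= b' -> coverable S N a b -> coverable S' N' a' b'.
Proof.
move=> SS' NN' aa' bb' [c [cN cS]]; exists c; split; first exact: le_trans NN'.
move=> p /SS' /cS[q qc [/andP[q1 q1'] /andP[q2 q2']]]; exists q => //.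
by rewrite q1 q2 (le_trans q1') ?lerD2l// (le_trans q2') ?lerD2l.
Qed.

Lemma itv_subdivision (q a x : R) k : (0 < k)%N -> 0 < a -> q <= x <= q + a ->
  exists2 i, (i < k)%N &
    q + i%:R * (a / k%:R) <= x <= q + i%:R * (a / k%:R) + a / k%:R.
Proof.
move=> k0 a0 /andP[qx xqa].
have kR0 : 0 < k%:R :> R by rewrite ltr0n.
have ak0 : 0 < a / k%:R by rewrite divr_gt0.
pose y := (x - q) / (a / k%:R).
have y0 : 0 <= y by rewrite divr_ge0 ?(ltW ak0)// subr_ge0.
have xE : x = q + y * (a / k%:R).
  by rewrite /y divfK ?gt_eqF// addrC subrK.
have yk : y <= k%:R.
  rewrite /y ler_pdivrMr// mulrCA divff ?gt_eqF// mulr1; lra.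
have [yk'|ky] := ltP y k%:R.
  exists (Num.truncn y).
    by rewrite -(ltr_nat R) (le_lt_trans _ yk')// truncn_le.
  have /andP[ty yt] := truncn_itv y0.
  have h1 := ler_wpM2r (ltW ak0) ty; have h2 := ler_wpM2r (ltW ak0) (ltW yt).
  by rewrite -natr1 mulrDl mul1r in h2; apply/andP; split; lra.
(* At the right endpoint the truncation would give k; the point belongs to the last closed piece. *)
exists k.-1; first by rewrite ltn_predL.
have {ky}yE : y = k%:R by apply/eqP; rewrite eq_le yk ky.
have kE : k%:R = k.-1%:R + 1 :> R by rewrite natr1 prednK.
have {}xE : x = q + (k.-1%:R + 1) * (a / k%:R) by rewrite -kE; move: xE;
  rewrite yE.
rewrite mulrDl mul1r in xE; have : 0 <= a / k%:R by exact: ltW.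
by move=> ?; apply/andP; split; lra.
Qed.

Lemma coverable_subdivision S N a b k l : (0 < k)%N -> (0 < l)%N ->
  0 < a -> 0 < b -> coverable S N a b ->
  coverable S (N * (k%:R * l%:R)) (a / k%:R) (b / l%:R).
Proof.
move=> k0 l0 a0 b0 [c [cN cS]].
exists [seq (qi.1.1 + qi.2%:R * (a / k%:R), qi.1.2 + j%:R * (b / l%:R)) |
  qi <- [seq (q, i) | q <- c, i <- iota 0 k], j <- iota 0 l]; split.
  by rewrite !size_allpairs !size_iota -mulnA natrM natrM ler_wpM2r.
move=> p /cS[q qc [q1 q2]].
have [i ik ip] := itv_subdivision k0 a0 q1.
have [j jl jp] := itv_subdivision l0 b0 q2.
exists (q.1 + i%:R * (a / k%:R), q.2 + j%:R * (b / l%:R)) => //.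
apply/allpairsP; exists ((q, i), j) => /=; split=> //.
  by apply/allpairsP; exists (q, i); rewrite mem_iota.
by rewrite mem_iota.
Qed.

(** Each box is replaced by one of sides a' and b' centred at a point of S in the old box, chosen by
    [xget]; the other points of S in it lie within half a side. No box is added. *)
Lemma coverable_contract S N a b a' b' :
  (forall p q, S p -> S q -> `|p.1 - q.1| <= a -> `|p.2 - q.2| <= b ->
    `|p.1 - q.1| <= a' / 2 /\ `|p.2 - q.2| <= b' / 2) ->
  coverable S N a b -> coverable S N a' b'.
Proof.
move=> H [c [cN cS]].
pose box (q : R * R) := [set p | S p /\
  (q.1 <= p.1 <= q.1 + a /\ q.2 <= p.2 <= q.2 + b)].
pose f q : R * R := ((xget q (box q)).1 - a' / 2, (xget q (box q)).2 - b' / 2).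
exists (map f c); split; first by rewrite size_map.
move=> p Sp; have [q qc qp] := cS _ Sp.
exists (f q); first exact: map_f.
have : box q (xget q (box q)) by apply: (@xgetPex _ q); exists p.
rewrite /f; move: (xget q (box q)) => z [Sz [z1 z2]] /=.
case: qp => q1 q2.
have [] := H p z Sp Sz.
- by rewrite ler_norml; lra.
- by rewrite ler_norml; lra.
- by rewrite !ler_norml; lra.
Qed.

Lemma coverable_square a b : 0 < a -> 0 < b ->
  coverable [set p : R * R | `|p.1| <= 2 /\ `|p.2| <= 2]
    ((4 / a + 1) * (4 / b + 1)) a b.
Proof.
move=> a0 b0.
have side (c : R) : 0 < c ->
    4 / (Num.truncn (4 / c)).+1%:R <= c /\ (Num.truncn (4 / c)).+1%:R <= 4 / c
      + 1.
  move=> c0; split.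
    by rewrite ler_pdivrMr// -ler_pdivrMl// mulrC ltW// truncnS_gt.
  by rewrite -natr1 lerD2r truncn_le divr_ge0// ltW.
have [a1 a2] := side _ a0; have [b1 b2] := side _ b0.
have cov : coverable [set p : R * R | `|p.1| <= 2 /\ `|p.2| <= 2] 1 4 4.
  exists [:: (-2, -2)]; split=> // p [p1 p2]; exists (-2, -2);
    first exact: mem_head.
  by move: p1 p2; rewrite /= !ler_norml => *; lra.
have p4 : 0 < 4 :> R by [].
have := coverable_subdivision (ltn0Sn (Num.truncn (4 / a)))
  (ltn0Sn (Num.truncn (4 / b))) p4 p4 cov.
apply: coverable_sub => //.
rewrite mul1r; exact: ler_pM.
Qed.

Lemma expR1_ge2 : 2 <= expR 1 :> R.
Proof. by have := @expR_ge1Dx R 1; lra. Qed.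

(* One step of the diagonal flow expands U by e^2 and e in its two coordinates;
   a subdivision into e^2 x e rectangles costs at most e^5. *)
Lemma coverable_expand S N a b : 0 < a -> 0 < b -> coverable S N a b ->
  coverable S (N * expR 5) (expR (- 2) * a) (expR (- 1) * b).
Proof.
move=> a0 b0 cov.
have N0 : 0 <= N by case: cov => c [+ _]; apply: le_trans.
have e2 := expR1_ge2.
have eq2 : expR 2 = expR 1 * expR 1 :> R by rewrite -expRD; congr expR; lra.
have eq3 : expR 3 = expR 1 * expR 1 * expR 1 :> R by rewrite -!expRD;
  congr expR; lra.
have k1 := truncnS_gt (expR 2 : R); have k2 := truncnS_gt (expR 1 : R).
have := @truncn_le R (expR 2); have := @truncn_le R (expR 1).
rewrite !expR_ge0 => l1 l2.
have := coverable_subdivision (ltn0Sn (Num.truncn (expR 2 : R)))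
  (ltn0Sn (Num.truncn (expR 1 : R))) a0 b0 cov.
apply: coverable_sub => //.
(* The two numbers of pieces are at most e^2 + 1 <= e^3 and e + 1 <= e^2; the weight 5 of a symbol 0
   in [cost] comes from here. *)
- rewrite ler_wpM2l// (le_trans (y := expR 3 * expR 2))//; last first.
    by rewrite -expRD le_eqVlt; apply/orP; left; apply/eqP; congr expR; lra.
  have h3 : expR 2 + 1 <= expR 3 :> R by rewrite eq3 eq2; nra.
  have h2 : expR 1 + 1 <= expR 2 :> R by rewrite eq2; nra.
  by apply: ler_pM => //; rewrite -natr1; lra.
- by rewrite mulrC ler_wpM2r ?(ltW a0)// expRN lef_pV2 ?posrE ?expR_gt0// ltW.
- by rewrite mulrC ler_wpM2r ?(ltW b0)// expRN lef_pV2 ?posrE ?expR_gt0// ltW.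
Qed.

(** Induction on time. At a time in [w], good points sharing a box are so close that the box shrinks
    for free by [coverable_contract]; at any other time it is subdivided at the price e^5 by
    [coverable_expand]. *)
Lemma coverable_itinerary (S0 : set (R * R)) (N a b : R)
    (good : nat -> set (R * R)) (w : pred nat) :
  0 < a -> 0 < b -> coverable S0 N a b ->
  (forall i p q, w i -> good i p -> good i q ->
    `|p.1 - q.1| <= expR (- (2 * i%:R)) * a -> `|p.2 - q.2| <= expR (- i%:R) *
      b ->
    `|p.1 - q.1| <= expR (- 2) / 2 * (expR (- (2 * i%:R)) * a) /\
    `|p.2 - q.2| <= expR (- 2) / 2 * (expR (- i%:R) * b)) ->
  forall L, coverable
    [set p | S0 p /\ forall i, (i < L)%N -> w i -> good i p]
    (N * expR (5 * (\sum_(i < L) ~~ w i)%:R))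
    (expR (- (2 * L%:R)) * a) (expR (- L%:R) * b).
Proof.
move=> a0 b0 cov rig; elim=> [|L IH].
  rewrite big_ord0 !mulr0 oppr0 expR0 mulr1 !mul1r.
  by apply: coverable_sub cov => // p [].
have aE : expR (- (2 * L.+1%:R)) * a = expR (- 2) * (expR (- (2 * L%:R)) * a).
  by rewrite mulrA -expRD; congr (expR _ * _); rewrite -natr1; ring.
have bE : expR (- L.+1%:R) * b = expR (- 1) * (expR (- L%:R) * b).
  by rewrite mulrA -expRD; congr (expR _ * _); rewrite -natr1; ring.
have aL0 : 0 < expR (- (2 * L%:R)) * a by rewrite mulr_gt0 ?expR_gt0.
have bL0 : 0 < expR (- L%:R) * b by rewrite mulr_gt0 ?expR_gt0.
rewrite big_ord_recr/= aE bE; case: (boolP (w L)) => wL /=.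
- rewrite addn0; apply: (@coverable_contract _ _ (expR (- (2 * L%:R)) * a)
  (expR (- L%:R) * b)).
    move=> p q [_ gp] [_ gq] pq1 pq2.
    have [H1 H2] := rig L p q wL (gp _ (ltnSn L) wL) (gq _ (ltnSn L) wL) pq1
      pq2.
    split; first by apply: le_trans H1 _; lra.
    (* The factor e^-2 is stronger than the e^-1 that the second coordinate requires. *)
    apply: le_trans H2 _; rewrite [leRHS]mulrAC ler_wpM2r ?(ltW bL0)//.
    by rewrite ler_wpM2r ?invr_ge0// ler_expR; lra.
  apply: coverable_sub IH => // p [Sp gp]; split=> // i iL; apply: gp.
  exact: ltnW.
- rewrite natrD mulrDr mulr1 expRD mulrA; apply: coverable_expand => //.
  apply: coverable_sub IH => // p [Sp gp]; split=> // i iL; apply: gp.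
  exact: ltnW.
Qed.

End rectangle_covers.

(** * Thin boundaries *)

Section thin_boundary.
Context {R : realType}.

(** A monotone function has countably many discontinuities, too few to fill an interval of positive
    length. Continuity is phrased as small oscillation across r, ready to bound the measure of a
    shell. *)
Lemma nondecreasing_continuity_point (G : R -> R) (a b : R) :
  {homo G : x y / x <= y} -> a < b ->
  exists2 r, a < r < b & forall e, 0 < e ->
    exists2 eta, 0 < eta & G (r + eta) - G (r - eta) <= e.
Proof.
move=> ndG ab.
have cD : countable [set x | x \in (`]a, b[) /\ discontinuity G x].
  by apply: discontinuity_countable => x y _ _; exact: ndG.
have [r [rab rND]] : exists r, r \in (`]a, b[) /\ ~ discontinuity G r.
  apply: contrapT => /forallNP H.
  have : (lebesgue_measure (`]a, b[%classic : set R) = 0)%E.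
    rewrite -(countable_lebesgue_measure0 cD); congr lebesgue_measure.
    apply/seteqP; split=> x /=; last by case.
    by move=> xab; split=> //; apply: contrapT => ?; exact: (H x).
  rewrite lebesgue_measure_itv/= lte_fin ab -EFinB => -[]; lra.
have /andP[ar rb] : a < r < b by move: rab; rewrite in_itv.
exists r; first by rewrite ar.
have cl : cvg (G x @[x --> r^'-]).
  apply: nondecreasing_at_left_is_cvgr.
  - by near=> z => x y _ _; exact: ndG.
  - by near=> z; exists (G r) => _ [y /= + <-]; rewrite in_itv/= =>
    /andP[_ /ltW/ndG].
have cr : cvg (G x @[x --> r^'+]).
  apply: nondecreasing_at_right_is_cvgr.
  - by near=> z => x y _ _; exact: ndG.
  - by near=> z; exists (G r) => _ [y /= + <-]; rewrite in_itv/= =>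
    /andP[/ltW/ndG].
have lr : lim (G x @[x --> r^'-]) = lim (G x @[x --> r^'+]).
  by apply/eqP/negPn/negP => ?; apply: rND.
move=> e e0.
have e20 : 0 < e / 2 by rewrite divr_gt0.
move/cvgrPdist_le : (cl) => /(_ _ e20) [dl /= dl0 Hl].
move/cvgrPdist_le : (cr) => /(_ _ e20) [dr /= dr0 Hr].
pose eta := Num.min dl dr / 2.
have m0 : 0 < Num.min dl dr by rewrite lt_min dl0 dr0.
have eta0 : 0 < eta by rewrite divr_gt0.
have etadl : eta < dl.
  by rewrite /eta ltr_pdivrMr// (@le_lt_trans _ _ dl) ?ge_min ?lexx//; lra.
have etadr : eta < dr.
  by rewrite /eta ltr_pdivrMr// (@le_lt_trans _ _ dr) ?ge_min ?lexx ?orbT//;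
    lra.
exists eta => //.
have bl : `|r - (r - eta)| < dl.
  by rewrite (_ : r - (r - eta) = eta) ?gtr0_norm//; ring.
have br : `|r - (r + eta)| < dr.
  by rewrite (_ : r - (r + eta) = - eta) ?normrN ?gtr0_norm//; ring.
have H1 : `|lim (G x @[x --> r^'-]) - G (r - eta)| <= e / 2.
  by apply: Hl => //; rewrite gtrBl.
have H2 : `|lim (G x @[x --> r^'+]) - G (r + eta)| <= e / 2.
  by apply: Hr => //; rewrite ltrDl.
rewrite lr in H1; move: H1 H2.
by rewrite !ler_norml => /andP[? ?] /andP[? ?]; lra.
Unshelve. all: by end_near. Qed.

(** One radius serves all j: [nondecreasing_continuity_point] is applied to the sum over j of the
    distribution functions, whose increments dominate those of each monotone term. *)
Lemma thin_boundary d (X : measurableType d)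
    (mu : {finite_measure set X -> \bar R}) (J : finType) (F : J -> X -> R)
    (a b : R) : (forall j, measurable_fun setT (F j)) -> a < b ->
  exists2 r, a < r < b & forall e : R, 0 < e ->
    exists2 eta : R, 0 < eta &
      forall j, (mu [set x | (`|F j x - r| < eta)%R] <= e%:E)%E.
Proof.
move=> mF ab.
have mle j y : measurable [set x | F j x <= y].
  rewrite (_ : mkset _ = F j @^-1` `]-oo, y]%classic).
    by rewrite -[X in measurable X]setTI; apply: mF.
  by apply/seteqP; split=> x /=; rewrite in_itv.
pose G y := \sum_j fine (mu [set x | F j x <= y]).
have ndG : {homo G : x y / x <= y}.
  move=> x y xy; apply: ler_sum => j _.
  rewrite fine_le ?fin_num_measure// le_measure ?inE//.
  by move=> z /= /le_trans; exact.
have [r rab Hr] := nondecreasing_continuity_point ndG ab.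
exists r => // e /Hr[eta eta0 Ge]; exists eta => // j.
have mA : measurable [set x | `|F j x - r| < eta].
  rewrite (_ : mkset _ = F j @^-1` `](r - eta), (r + eta)[%classic).
    by rewrite -[X in measurable X]setTI; apply: mF.
  by apply/seteqP; split=> x /=; rewrite in_itv/= ltr_distl.
rewrite -[mu _]fineK ?fin_num_measure// lee_fin (le_trans _ Ge)//.
rewrite /G -sumrB (bigD1 j)//= -[leLHS]addr0 lerD//; last first.
  apply: sumr_ge0 => i _; rewrite subr_ge0.
  rewrite fine_le ?fin_num_measure// le_measure ?inE//.
  by move=> z /= /le_trans; apply; lra.
rewrite lerBrDr -fineD ?fin_num_measure// fine_le ?fin_numD ?fin_num_measure//.
rewrite -measureU//; last first.
  apply/seteqP; split=> // z [/=]; rewrite ltr_distl => /andP[+ _]; lra.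
rewrite le_measure ?inE//; first exact: measurableU.
by move=> z [/=|/=]; rewrite ?ltr_distl => ?; lra.
Qed.

End thin_boundary.

(** * Coding of orbits *)

Section integral_lower_bound.
Local Open Scope ereal_scope.
Context {d} {T : measurableType d} {R : realType}.
Variable mu : {measure set T -> \bar R}.

Lemma integral_ge_sum (I : finType) (A : I -> set T) (c : I -> R) (D : set T)
    (f : T -> R) :
  measurable D -> measurable_fun D f -> (forall x, D x -> 0 <= f x)%R ->
  (forall i, measurable (A i)) -> trivIset setT A ->
  (forall i, A i `<=` D) -> (forall i, 0 <= c i)%R -> (forall i x, A i x -> c i
    <= f x)%R ->
  \sum_i (c i)%:E * mu (A i) <= \int[mu]_(x in D) (f x)%:E.
Proof.
move=> mD mf f0 mA tA AD c0 cf.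
have mU : measurable (\big[setU/set0]_(i <- enum I) A i).
  by apply: bigsetU_measurable => i _.
have UD : \big[setU/set0]_(i <- enum I) A i `<=` D.
  by rewrite -bigcup_seq => x [i _]; exact: AD.
have mfD : measurable_fun D (fun x => (f x)%:E) by exact/measurable_EFinP.
apply: (@le_trans _ _ (\int[mu]_(x in \big[setU/set0]_(i <- enum I) A i) (f
  x)%:E));
  last by apply: ge0_subset_integral => // x /f0; rewrite lee_fin.
rewrite ge0_integral_bigsetU ?enum_uniq//; last 3 first.
- by move/trivIsetP : tA => tA; apply/trivIsetP => i j _ _; exact: tA.
- exact: measurable_funS mfD.
- by move=> x /UD /f0; rewrite lee_fin.
rewrite big_enum/=; apply: lee_sum => i _; rewrite -integral_cst//.
apply: ge0_le_integral => //.
- by move=> x _; rewrite lee_fin.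
- exact: measurable_funS mfD.
- by move=> x Ax; rewrite lee_fin; exact: cf.
Qed.

End integral_lower_bound.

Section coding.
Context {R : realType}.
Local Notation X := (quot_space R).
Variables (k : nat) (h : 'I_k -> 'M[R]_3) (r : R).
Local Notation F := (fun j => orbit_dist (h j)).
Local Notation f := (quot_act (a_elt 1 0) : X -> X).

(** Symbol 0 stands for the complement of all balls. Where balls overlap, [pick] selects one, which
    turns the cover into a partition. *)
Definition ball_code (b : {ffun 'I_k -> bool}) : 'I_k.+1 :=
  oapp (lift ord0) ord0 [pick j | b j].

Definition symbol (x : X) : 'I_k.+1 := ball_code [ffun j => F j x < r].

Lemma symbol_neq0 x j : symbol x = lift ord0 j -> F j x < r.
Proof.
rewrite /symbol /ball_code; case: pickP => [j'|_] /=.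
  by rewrite ffunE => Fj' /lift_inj <-.
by move=> /eqP; rewrite (negbTE (neq_lift _ _)).
Qed.

Lemma symbol_eq0 x : symbol x = ord0 -> forall j, r <= F j x.
Proof.
rewrite /symbol /ball_code; case: pickP => [j' _|H] /=.
  by move=> /eqP; rewrite eq_sym (negbTE (neq_lift _ _)).
by move=> _ j; have := H j; rewrite ffunE leNgt => /negbT.
Qed.

Lemma symbol_partition : measurable_partition (fun i => [set x | symbol x = i]).
Proof.
split.
- move=> i.
  rewrite (_ : mkset _ = \bigcup_(b in [set b | ball_code b = i])
    \bigcap_(j in [set: 'I_k]) [set x | (F j x < r) = b j]); last first.
    apply/seteqP; split=> [x /= xi|x [b <- /= xb]].
      by exists [ffun j => F j x < r] => //= j _ /=; rewrite ffunE.
    by congr ball_code; apply/ffunP => j; rewrite ffunE xb.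
  apply: fin_bigcup_measurable => // b _.
  apply: fin_bigcap_measurable => // j _.
  rewrite (_ : mkset _ = F j @^-1` (if b j then `]-oo, r[%classic else `[r,
    +oo[%classic)).
    rewrite -[X in measurable X]setTI; apply: measurable_orbit_dist => //.
    by case: ifP.
  apply/seteqP; split=> x /=; case: (b j); rewrite /= in_itv/= ?andbT => //.
    by rewrite leNgt => ->.
  by rewrite leNgt => /negbTE.
- by apply/trivIsetP => i j _ _ /eqP ij; apply/seteqP; split=> // x [/= -> /ij].
- by apply/seteqP; split=> // x _; exists (symbol x).
Qed.

Definition itinerary n (x : X) : {ffun 'I_n -> 'I_k.+1} :=
  [ffun i : 'I_n => symbol (iter i f x)].

Lemma itinerary_atomE n w :
  itinerary_atom f (fun i =>
    [set x | symbol x = i]) w = [set x | itinerary n x = w].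
Proof.
apply/seteqP; split=> [x /= xw|x /= <- i]; last by rewrite ffunE.
by apply/ffunP => i; rewrite ffunE xw.
Qed.

Lemma continuous_iter_act n : continuous (iter n f).
Proof.
elim: n => [|n IH] x; first exact: cvg_id.
by apply: (continuous_comp (IH x)); exact: continuous_quot_act.
Qed.

Lemma continuous_orbit_dist_iter n j : continuous (fun x => F j (iter n f x)).
Proof.
move=> x; apply: (continuous_comp (@continuous_iter_act n x)).
exact: continuous_orbit_dist.
Qed.

Lemma itinerary_locally_constant n x :
  (forall (i : 'I_n) j, F j (iter i f x) != r) ->
  \forall y \near x, itinerary n y = itinerary n x.
Proof.
move=> xr.
have H (i : 'I_n) j : \forall y \near x,
    (F j (iter i f y) < r) = (F j (iter i f x) < r).
  have := @continuous_orbit_dist_iter i j x.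
  case: (ltgtP (F j (iter i f x)) r) (xr i j) => // Fr _ cF.
    near=> y; near: y; exact: (cvgr_lt _ cF).
  near=> y; apply/negbTE; rewrite -leNgt ltW//; near: y; exact: (cvgr_gt _ cF).
have HH : \forall y \near x, forall (i : 'I_n) j,
    (F j (iter i f y) < r) = (F j (iter i f x) < r).
  apply: (filter_forall (F := nbhs x)) => i.
  by apply: (filter_forall (F := nbhs x)) => j; exact: H.
near=> y; apply/ffunP => i; rewrite !ffunE; congr ball_code.
apply/ffunP => j; rewrite !ffunE; move: i j; near: y; exact: HH.
Unshelve. all: by end_near. Qed.

Definition tent n (eta : R) (x : X) : R :=
  \prod_(ij : 'I_n * 'I_k) Num.min 1 (`|F ij.2 (iter ij.1 f x) - r| / eta).

Lemma tent_itv n eta x : 0 < eta -> 0 <= tent n eta x <= 1.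
Proof.
move=> eta0; have H (ij : 'I_n * 'I_k) : 0 <= Num.min 1 (`|F ij.2 (iter ij.1 f
  x) - r| / eta) <= 1.
  by rewrite le_min ler01 divr_ge0 ?(ltW eta0)//= ge_min lexx.
apply/andP; split; first by apply: prodr_ge0 => ij _; case/andP: (H ij).
by apply: prodr_ile1 => ij _; exact: H.
Qed.

Lemma tent_eq1 n eta x : 0 < eta ->
  (forall (i : 'I_n) j, eta <= `|F j (iter i f x) - r|) -> tent n eta x = 1.
Proof.
move=> eta0 H; rewrite /tent big1// => -[i j] _ /=.
by apply/min_idPl; rewrite ler_pdivlMr// mul1r.
Qed.

Lemma continuous_tent n eta : continuous (tent n eta).
Proof.
apply: continuous_big => [|[i j] _ /= x]; first exact: mul_continuous.
apply: (@continuous_min _ _ (fun=> 1)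
  (fun x => `|F j (iter i f x) - r| / eta) x); first exact: cst_continuous.
apply: (@continuousM _ _ (fun x => `|F j (iter i f x) - r|) (fun=> eta^-1) x);
  last exact: cst_continuous.
apply: (@continuous_comp _ _ _ (fun x => F j (iter i f x) - r) (fun y =>
  `|y|) x);
  last exact: norm_continuous.
apply: (@continuousB _ _ _ (fun x => F j (iter i f x)) (fun=> r) x);
  [exact: continuous_orbit_dist_iter|exact: cst_continuous].
Qed.

Variables (n : nat) (c : {ffun 'I_n -> 'I_k.+1} -> R).
Hypothesis c_ge0 : forall w, 0 <= c w.
Hypothesis c0 : c [ffun=> ord0] = 0.
Variable eta : R.
Hypothesis eta0 : 0 < eta.

(* A continuous substitute for c o itinerary, which jumps on the boundary of the
   partition; it is only smaller, and vanishes at infinity. *)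
Definition gain (x : X) : R := c (itinerary n x) * tent n eta x.

Lemma gain_ge0 x : 0 <= gain x.
Proof. by rewrite mulr_ge0//; case/andP: (tent_itv n x eta0). Qed.

Lemma gain_le x : gain x <= c (itinerary n x).
Proof. by rewrite ler_piMr//; case/andP: (tent_itv n x eta0). Qed.

(** Off the spheres the itinerary is locally constant; on them [gain] is 0 and is squeezed between 0
    and a multiple of the continuous [tent]. *)
Lemma continuous_gain : continuous gain.
Proof.
move=> x.
have [xr|] := pselect (forall (i : 'I_n) j, F j (iter i f x) != r).
  have H : \forall y \near x, c (itinerary n x) * tent n eta y = gain y.
    near=> y; rewrite /gain; congr (c _ * _); apply/esym.
    by near: y; exact: itinerary_locally_constant.
  apply: cvg_trans (near_eq_cvg H) _.
  apply: (@continuousM _ _ (fun=> c (itinerary n x)) (tent n eta) x).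
    exact: cst_continuous.
  exact: continuous_tent.
move=> /existsNP[i /existsNP[j /negP/negPn/eqP xr]].
have tx : tent n eta x = 0.
  by rewrite /tent (bigD1 (i, j))//= xr subrr normr0 mul0r min_r ?mul0r.
have gx : gain x = 0 by rewrite /gain tx mulr0.
pose C := \sum_w c w.
have cC w : c w <= C by rewrite /C (bigD1 w)//= lerDl sumr_ge0.
apply: (@squeeze_cvgr _ (nbhs x) _ _ (fun=> 0) (fun y =>
  C * tent n eta y) gain).
- near=> y; rewrite gain_ge0 /gain ler_wpM2r//.
  by case/andP: (tent_itv n y eta0).
- by rewrite gx; exact: cvg_cst.
- rewrite gx -[X in _ --> X](mulr0 C) -tx.
  apply: (@continuousM _ _ (fun=> C) (tent n eta) x);
    first exact: cst_continuous.
  exact: continuous_tent.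
Unshelve. all: by end_near. Qed.

(** As [c] kills the zero word, a nonzero gain forces some iterate to have a basis near some [h j].
    Flowing back fewer than n steps gives x a basis of norm at most [B]. *)
Lemma gain_vanishes : vanishes_at_infinity gain.
Proof.
move=> e e0.
pose B := \sum_(i < n) \sum_j 3 * `|a_mx (- (i : nat)%:R) 0 : 'M[R]_3| * (`|h
  j| + `|r|).
exists (@quot_proj R @` [set g : SL3 R | `|mx_of g| <= B]).
  exact: compact_quot_le.
move=> x nKx; suff -> : gain x = 0 by rewrite normr0.
suff itx : itinerary n x = [ffun=> ord0] by rewrite /gain itx c0 mul0r.
apply/ffunP => i; rewrite !ffunE.
case: (unliftP ord0 (symbol (iter i f x))) => [j|//] /symbol_neq0.
rewrite iter_quot_act => /orbit_dist_ltP[g gx gh].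
exfalso; apply: nKx; exists (a_elt (- (i : nat)%:R) 0 * g)%g => /=; last first.
  rewrite -quot_act_proj gx quot_act_aD addNr addr0 -(iter_quot_act 0).
  by [].
have gB : `|mx_of g| <= `|h j| + `|r|.
  rewrite -[mx_of g](subrK (h j)) (le_trans (ler_normD _ _))// addrC lerD2l.
  by rewrite (le_trans (ltW gh))// ler_norm.
apply: le_trans (mx_norm_mul _ _) _.
rewrite /B (bigD1 i)//= (bigD1 j)//= -addrA.
apply: ler_wpDr; last by rewrite ler_wpM2l.
by rewrite addr_ge0// ?sumr_ge0// => *; rewrite ?sumr_ge0// => *;
  rewrite !mulr_ge0// addr_ge0.
Qed.

End coding.

(** * Cost of a code *)

Section code_lengths.
Context {R : realType}.

(* Shannon code lengths for a mixture of p, the uniform law and a Dirac mass. *)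
Lemma code_lengths (I : finType) (p : I -> R) (i0 : I) :
  (forall i, 0 <= p i) -> \sum_i p i <= 1 ->
  exists l : I -> nat, [/\ \sum_i expR (- (l i)%:R) <= 1 :> R,
    \sum_i p i * (l i)%:R <= 3 - \sum_i p i * ln (p i) & (l i0 <= 3)%N].
Proof.
move=> p0 p1.
have I0 : 0 < #|I|%:R :> R by rewrite ltr0n; apply/card_gt0P; exists i0.
have e2 : 4 <= expR 2 :> R.
  have := @expR_ge1Dx R 1; have -> : expR 2 = expR 1 * expR 1 :> R.
    by rewrite -expRD; congr expR; lra.
  by nra.
have ln4 : ln 4 <= 2 :> R by rewrite -(expRK 2) ler_ln ?posrE ?expR_gt0//; lra.
(* The uniform part keeps q positive where p vanishes and the Dirac part gives q i0 >= 1 / 4.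
   Dividing by 4 adds ln 4 <= 2 to a length and rounding up adds at most 1, hence the two constants
   3. *)
pose q i : R := (p i + #|I|%:R^-1 + (i == i0)%:R) / 4.
have pI i : 0 < p i + #|I|%:R^-1 by rewrite ltr_wpDl ?invr_gt0.
have q0 i : 0 < q i by rewrite divr_gt0// ltr_wpDr.
have sumq : \sum_i q i <= 1.
  rewrite -mulr_suml !big_split/= sumr_const.
  rewrite [X in _ + X](bigD1 i0)//= eqxx [X in _ + (_ + X)]big1; last first.
    by move=> i /negbTE ->.
  have -> : (#|I|%:R^-1 : R) *+ #|I| = 1 by rewrite -[LHS]mulr_natl divff
    ?gt_eqF.
  by rewrite mulr1n; lra.
have q1 i : q i <= 1.
  by apply: le_trans sumq; rewrite (bigD1 i)//= lerDl sumr_ge0// => j _;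
    exact: ltW.
have lq0 i : 0 <= - ln (q i) by rewrite oppr_ge0 ln_le0.
pose l i := (Num.truncn (- ln (q i))).+1.
have lq i : - ln (q i) <= (l i)%:R <= 1 - ln (q i).
  have /andP[H1 H2] := truncn_itv (lq0 i).
  by rewrite ltW//= /l -natr1 addrC lerD2l.
exists l; split.
- apply: le_trans sumq; apply: ler_sum => i _.
  rewrite -[leRHS]lnK ?posrE// ler_expR lerNl.
  by case/andP: (lq i).
- have H i : p i * (l i)%:R <= p i * 3 - p i * ln (p i).
    have [->|pi0] := eqVneq (p i) 0; first by rewrite !mul0r subr0.
    rewrite -mulrBr ler_wpM2l//.
    have pgt0 : 0 < p i by rewrite lt_neqAle eq_sym pi0 p0.
    have : ln (p i / 4) <= ln (q i).
      rewrite ler_ln ?posrE ?q0 ?divr_gt0// /q ler_pM2r ?invr_gt0 // -addrA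
        lerDl.
      by rewrite addr_ge0// invr_ge0.
    rewrite ln_div ?posrE// => H; have /andP[_ H2] := lq i; lra.
  apply: (@le_trans _ _ (\sum_i (p i * 3 - p i * ln (p i))));
    first exact: ler_sum.
  by rewrite sumrB lerD2r -mulr_suml; lra.
- rewrite /l ltnS -(ler_nat R).
  have : ln (4^-1) <= ln (q i0).
    rewrite ler_ln ?posrE ?invr_gt0// /q eqxx ler_pdivlMr// mulVf//.
    by rewrite lerDr ltW.
  rewrite lnV ?posrE// => H.
  have : (Num.truncn (- ln (q i0)))%:R <= - ln (q i0) by rewrite truncn_le.
  by lra.
Qed.

End code_lengths.

Section entropy_cost.
Context {R : realType}.
Local Notation X := (quot_space R).
Variables (k : nat) (h : 'I_k -> 'M[R]_3) (r : R).
Local Notation f := (quot_act (a_elt 1 0) : X -> X).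
Local Notation symbol := (symbol h r).
Local Notation itinerary := (itinerary h r).
Local Notation word n := {ffun 'I_n -> 'I_k.+1}.

Definition zeros n (w : word n) : nat := \sum_(i < n) (w i == ord0).

Definition cost n (l : word n -> nat) (w : word n) : nat :=
  (l w + 5 * zeros w)%N.

Definition zero_word n : word n := [ffun=> ord0].

Lemma zeros_zero_word n : zeros (zero_word n) = n.
Proof.
rewrite /zeros (eq_bigr (fun=> 1%N)) ?sum1_card ?card_ord// => i _.
by rewrite ffunE eqxx.
Qed.

Lemma itinerary_partition n :
  finite_partition (fun w : word n => [set x : X | itinerary n x = w]).
Proof.
have := itinerary_atom_partition (@measurable_quot_act R (a_elt 1 0))
  (symbol_partition h r) n.
rewrite (_ : @itinerary_atom _ _ f _ _ n = fun w : word n =>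
  [set x : X | itinerary n x = w])//.
by apply/funext => w; exact: itinerary_atomE.
Qed.

Variable mu : {finite_measure set X -> \bar R}.
Hypothesis f_mu : forall E, measurable E -> mu (f @^-1` E) = mu E.

(** Off the set [B] where one of the n iterates meets one of the k shells, [gain] is [c] of the
    itinerary. By invariance [B] has mass at most n k e, and at most C is lost on it. *)
Lemma gain_integral n (c : word n -> R) (C eta e : R) :
  (forall w, 0 <= c w <= C) -> 0 < eta ->
  (forall j, (mu [set x | (`|orbit_dist (h j) x - r| < eta)%R] <= e%:E)%E) ->
  ((\sum_w c w * fine (mu [set x | itinerary n x = w]) -
    C * ((n * k)%:R * e))%:E <= \int[mu]_x (gain h r c eta x)%:E)%E.
Proof.
move=> cC eta0 thin.
have c0 w : 0 <= c w by case/andP: (cC w).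
have C0 : 0 <= C by have /andP[/le_trans] := cC (zero_word n); apply.
pose S (ij : 'I_n * 'I_k) :=
  iter ij.1 f @^-1` [set x | `|orbit_dist (h ij.2) x - r| < eta].
have mS0 j : measurable [set x : X | `|orbit_dist (h j) x - r| < eta].
  rewrite (_ : mkset _ = orbit_dist (h j) @^-1` `](r - eta), (r +
    eta)[%classic).
    rewrite -[X in measurable X]setTI.
    exact: measurable_orbit_dist.
  by apply/seteqP; split=> x /=; rewrite in_itv/= ltr_distl.
have mS ij : measurable (S ij).
  rewrite -[X in measurable X]setTI; apply: measurable_iter => //.
  exact: measurable_quot_act.
pose B := \bigcup_ij S ij.
have mB : measurable B by apply: fin_bigcup_measurable => // ij _; exact: mS.
have muB : fine (mu B) <= (n * k)%:R * e.
  rewrite -lee_fin fineK ?fin_num_measure//.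
  have -> : B = \big[setU/set0]_(ij <- enum {: 'I_n * 'I_k}) S ij.
    rewrite -bigcup_seq; apply/seteqP; split=> x [ij _ Sx]; exists ij => //=.
    by rewrite mem_enum.
  apply: (@le_trans _ _ (\sum_(ij <- enum {: 'I_n * 'I_k}) mu (S ij))%E).
    elim: (enum _) => [|ij s IH]; first by rewrite !big_nil measure0.
    rewrite !big_cons (le_trans (measureU2 _ _ _))//; last exact: leeD2l.
    by apply: bigsetU_measurable => *.
  apply: (@le_trans _ _ (\sum_(ij <- enum {: 'I_n * 'I_k}) e%:E)%E).
    apply: lee_sum => -[i j] _;
      rewrite (measure_iter (@measurable_quot_act R _) f_mu)//; exact: thin.
  rewrite sumEFin big_enum/= sumr_const card_prod !card_ord lee_fin.
  by rewrite mulr_natl.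
have [mI tI cI] := itinerary_partition n.
pose A w := [set x : X | itinerary n x = w] `\` B.
have mA w : measurable (A w) by exact: measurableD.
apply: (@le_trans _ _ (\sum_w (c w)%:E * mu (A w))%E); last first.
  apply: integral_ge_sum => //.
  - by apply: measurable_continuous_quot; exact: continuous_gain.
  - by move=> x _; exact: gain_ge0.
  - apply/trivIsetP => i j _ _ ij; move/trivIsetP : tI =>
    /(_ _ _ Logic.I Logic.I ij).
    by move=> H; apply/seteqP; split=> // x [[xi _] [xj _]]; rewrite -H; split.
  - move=> w x [/= xw nB]; rewrite /gain xw tent_eq1 ?mulr1// => i j.
    rewrite leNgt; apply/negP => H; apply: nB; by exists (i, j).
have -> : (\sum_w (c w)%:E * mu (A w))%E = (\sum_w c w * fine (mu (A w)))%:E.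
  rewrite -sumEFin; apply: eq_bigr => w _.
  by rewrite EFinM fineK ?fin_num_measure.
rewrite lee_fin lerBlDr.
apply: (@le_trans _ _ (\sum_w c w * fine (mu (A w)) + C * fine (mu B)));
  last first.
  by rewrite lerD2l ler_wpM2l.
rewrite (fine_measure_partition mu (itinerary_partition n) mB) mulr_sumr
  -big_split/=.
apply: ler_sum => w _.
have -> : fine (mu [set x | itinerary n x = w]) =
    fine (mu (A w)) + fine (mu (B `&` [set x | itinerary n x = w])).
  rewrite -fineD ?fin_num_measure//; last exact: measurableI.
  congr fine; rewrite [B `&` _]setIC; exact: measureDI.
rewrite mulrDr lerD2l ler_wpM2r ?fine_ge0//.
by case/andP: (cC w).
Qed.

Lemma sum_zeros n :
  \sum_w (zeros w)%:R * fine (mu [set x | itinerary n x = w]) =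
  n%:R * fine (mu [set x | symbol x = ord0]).
Proof.
have mI := itinerary_partition n.
have [mS _ _] := symbol_partition h r.
under eq_bigr do rewrite /zeros natr_sum mulr_suml.
rewrite exchange_big/= -[X in X%:R * _](card_ord n) -sum1_card natr_sum
  mulr_suml.
apply: eq_bigr => i _; rewrite mul1r.
have <- : mu (iter i f @^-1` [set x | symbol x = ord0]) = mu [set x | symbol x
  = ord0].
  by rewrite (measure_iter (@measurable_quot_act R _) f_mu)//; exact: mS.
have mi : measurable (iter i f @^-1` [set x | symbol x = ord0]).
  have mfi := measurable_iter (@measurable_quot_act R (a_elt 1 0)) i.
  by rewrite -[X in measurable X]setTI; apply: mfi => //; exact: mS.
rewrite (fine_measure_partition mu mI mi); apply: eq_bigr => w _.
case: eqP => wi.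
  rewrite mul1r; congr (fine (mu _)); apply/seteqP; split=> [x /= xw|x []//].
  by split=> //; rewrite -wi -xw ffunE.
rewrite mul0r (_ : _ `&` _ = set0) ?measure0//.
by apply/seteqP; split=> // x [/= x0 xw]; apply: wi; rewrite -xw ffunE.
Qed.

(** The contributions are 3 + 2 gamma n from the code lengths, gamma n from the times outside the
    balls, and 3 + 5 gamma n from the escaped mass, charged as the zero word. As gamma n >= 6, the
    sum is at most 9 gamma n. *)
Lemma cost_bound (P0 : probability X R) (gamma : R) N :
  0 < gamma < 1 -> ((1 - gamma)%:E < mu setT)%E -> (mu setT <= 1)%E ->
  (ks_entropy (mnormalize mu P0) f <= gamma%:E)%E ->
  (mu [set x | symbol x = ord0] <= (gamma / 5)%:E)%E ->
  exists n (l : word n -> nat), [/\ (N <= n)%N, \sum_w expR (- (l w)%:R) <= 1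
    :> R &
    (cost l (zero_word n))%:R * (1 - fine (mu setT)) +
      \sum_w (cost l w)%:R * fine (mu [set x | itinerary n x = w]) <= 9 * gamma
        * n%:R].
Proof.
move=> /andP[g0 g1] mug mu1 ksg mu0.
set m := fine (mu setT).
have muE : mu setT = m%:E by rewrite fineK ?fin_num_measure.
have gm : 1 - gamma < m by rewrite -lte_fin -muE.
have m1 : m <= 1 by rewrite -lee_fin -muE.
have m0 : 0 < m by lra.
set nu := mnormalize mu P0.
have nuE E : nu E = (mu E * (m^-1)%:E)%E.
  by rewrite /nu /mnormalize/= muE eqe gt_eqF//=.
have f_nu E : measurable E -> nu (f @^-1` E) = nu E.
  by move=> mE; rewrite !nuE f_mu.
pose N' := maxn N (Num.truncn (6 / gamma)).+1.
(* The hypothesis is not strict while [ks_entropy_lt] needs a strict bound; doubling gamma > 0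
   provides it. *)
have ks2 : (ks_entropy nu f < (2 * gamma)%:E)%E.
  by rewrite (le_lt_trans ksg)// lte_fin; lra.
have [n N'n Hn] := ks_entropy_lt (@measurable_quot_act R (a_elt 1 0)) f_nu
  (symbol_partition h r) N' ks2.
have n6 : 6 <= gamma * n%:R.
  rewrite mulrC -ler_pdivrMr// (le_trans (ltW (truncnS_gt _)))// ler_nat.
  by rewrite (leq_trans (leq_maxr _ _) N'n).
pose A w := [set x : X | itinerary n x = w].
have [mA _ cA] := itinerary_partition n.
pose p w := fine (nu (A w)).
have pE w : fine (mu (A w)) = m * p w.
  rewrite /p nuE fineM ?fin_num_measure//=; last exact: mA.
  by rewrite mulrCA divff ?gt_eqF// mulr1.
have p0 w : 0 <= p w by exact: fine_ge0.
have mass : \sum_w fine (mu (A w)) = m.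
  rewrite /m (fine_measure_partition mu (itinerary_partition n) measurableT).
  by apply: eq_bigr => w _; rewrite setTI.
have p1 : \sum_w p w <= 1.
  have : m * \sum_w p w = m by rewrite mulr_sumr -[RHS]mass; apply: eq_bigr =>
    w _.
  by rewrite -[X in _ = X -> _]mulr1 => /(mulfI (lt0r_neq0 m0)) ->.
have [l [kraft lp l0]] := code_lengths (zero_word n) p0 p1.
exists n, l; split=> //; first exact: leq_trans (leq_maxl _ _) N'n.
have H2 : - \sum_w p w * ln (p w) <= 2 * gamma * n%:R.
  apply: le_trans Hn; rewrite /static_entropy.
  rewrite le_eqVlt; apply/orP; left; apply/eqP; congr (- _).
  by apply: eq_bigr => w _; rewrite itinerary_atomE.
have -> : \sum_w (cost l w)%:R * fine (mu (A w)) =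
    m * (\sum_w p w * (l w)%:R) + 5 * \sum_w (zeros w)%:R * fine (mu (A w)).
  rewrite !mulr_sumr -big_split/=; apply: eq_bigr => w _.
  by rewrite /cost natrD natrM pE; ring.
rewrite (sum_zeros n).
have Hz : fine (mu [set x | symbol x = ord0]) <= gamma / 5.
  rewrite -lee_fin fineK// fin_num_measure//.
  by have [] := symbol_partition h r.
have Hl : m * (\sum_w p w * (l w)%:R) <= 3 + 2 * gamma * n%:R.
  apply: (@le_trans _ _ (\sum_w p w * (l w)%:R)).
    by rewrite ler_piMl// sumr_ge0// => w _; rewrite mulr_ge0.
  by apply: le_trans lp _; lra.
have Hc : (cost l (zero_word n))%:R * (1 - m) <= 3 + 5 * gamma * n%:R.
  rewrite /cost zeros_zero_word natrD natrM mulrDl; apply: lerD.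
    rewrite -[leRHS]mulr1 ler_pM//; last by lra.
      by rewrite subr_ge0.
    by rewrite (ler_nat _ _ 3).
  by rewrite -!mulrA ler_wpM2l// mulrC ler_wpM2r//; lra.
have Hzn : 5 * (n%:R * fine (mu [set x | symbol x = ord0])) <= gamma * n%:R.
  rewrite (le_trans (y := 5 * (n%:R * (gamma / 5))))//.
    by rewrite ler_wpM2l// ler_wpM2l.
  by rewrite le_eqVlt; apply/orP; left; apply/eqP; field.
by lra.
Qed.

End entropy_cost.

(** * Grids in the plane of times *)

Section finite_partition_sums.
Context {d} {T : measurableType d} {R : realType}.

Lemma integral_le_sum (mu : {measure set T -> \bar R}) (I : finType)
    (A : I -> set T) (c : I -> R) (f : T -> R) :
  finite_partition A -> measurable_fun setT f -> (forall x, 0 <= f x) ->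
  (forall i x, A i x -> f x <= c i) ->
  (\int[mu]_x (f x)%:E <= \sum_i (c i)%:E * mu (A i))%E.
Proof.
move=> [mA tA cA] mf f0 fc.
have mfE : measurable_fun setT (fun x => (f x)%:E) by exact/measurable_EFinP.
have TE : setT = \big[setU/set0]_(i <- enum I) A i.
  rewrite -bigcup_seq -cA; apply/seteqP; split=> x [i _ Ax]; exists i => //=.
  by rewrite mem_enum.
rewrite [X in (\int[_]_(_ in X) _)%E]TE.
rewrite ge0_integral_bigsetU ?enum_uniq//; last 3 first.
- by move/trivIsetP : tA => tA; apply/trivIsetP => i j _ _; exact: tA.
- exact: measurable_funS mfE.
- by move=> x _; rewrite lee_fin.
rewrite big_enum/=; apply: lee_sum => i _; rewrite -integral_cst//.
apply: ge0_le_integral => //.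
- by move=> x _; rewrite lee_fin.
- exact: measurable_funS mfE.
- by move=> x Ax; rewrite lee_fin; exact: fc.
Qed.

Lemma fine_measure_trivIset (mu : {finite_measure set T -> \bar R})
    (C : finType) (Q : C -> set T) (A : set T) :
  (forall c, measurable (Q c)) -> trivIset setT Q -> measurable A ->
  \sum_c fine (mu (A `&` Q c)) <= fine (mu A).
Proof.
move=> mQ tQ mA.
have mAQ c : measurable (A `&` Q c) by exact: measurableI.
have tAQ : trivIset setT (fun c => A `&` Q c).
  move/trivIsetP : tQ => tQ; apply/trivIsetP => i j _ _ ij.
  by rewrite setIACA tQ// setI0.
rewrite sum_fine; last by move=> c _; exact: fin_num_measure.
have -> : (\sum_c mu (A `&` Q c) = mu (\bigcup_c (A `&` Q c)))%E.
  rewrite measure_fin_bigcup//.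
  rewrite (fsbigE (enum C))//= ?enum_uniq//; last by move=> i _;
    rewrite mem_enum.
    by rewrite big_enum_cond/=; apply: eq_bigl => i; rewrite in_setT.
  exact: finite_finset.
have mU : measurable (\bigcup_c (A `&` Q c)) by exact: fin_bigcup_measurable.
rewrite fine_le ?fin_num_measure// le_measure ?inE//.
by move=> x [c _ []].
Qed.

(** Both sides are compared on the pieces [S w] meet [Q c]; a nonempty piece contains a point at
    which the hypothesis compares the two weights. *)
Lemma partition_cells (mu : {finite_measure set T -> \bar R}) (W C : finType)
    (S : W -> set T) (Q : C -> set T) (b : W -> R) (m : C -> R) :
  finite_partition S -> (forall c, measurable (Q c)) -> trivIset setT Q ->
  (forall w, 0 <= b w) ->
  (forall c w x, Q c x -> S w x -> m c <= b w) ->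
  \sum_c m c * fine (mu (Q c)) <= \sum_w b w * fine (mu (S w)).
Proof.
move=> pS mQ tQ b0 mb; have [mS _ _] := pS.
apply: (@le_trans _ _ (\sum_w b w * \sum_c fine (mu (S w `&` Q c))));
  last first.
  by apply: ler_sum => w _; rewrite ler_wpM2l// fine_measure_trivIset.
under [leRHS]eq_bigr do rewrite mulr_sumr.
rewrite exchange_big/=; apply: ler_sum => c _.
rewrite (fine_measure_partition mu pS (mQ c)) mulr_sumr; apply: ler_sum => w _.
rewrite setIC; have [->|/set0P[x [Sx Qx]]] := eqVneq (S w `&` Q c) set0.
  by rewrite measure0 !mulr0.
by rewrite ler_wpM2r ?fine_ge0//; exact: mb Qx Sx.
Qed.

End finite_partition_sums.

Section grid.
Context {R : realType}.
Local Notation leb2 := ((@lebesgue_measure R) \x (@lebesgue_measure R))%E.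

Definition grid_cell (K p q : nat) : set (R * R) :=
  `[p%:R / K%:R, p.+1%:R / K%:R[ `*` `[q%:R / K%:R, q.+1%:R / K%:R[.

Lemma measurable_grid_cell K p q : measurable (grid_cell K p q).
Proof. by apply: measurableX; exact: measurable_itv. Qed.

Lemma grid_cell_measure K p q : (0 < K)%N ->
  leb2 (grid_cell K p q) = ((K%:R ^+ 2)^-1)%:E.
Proof.
move=> K0; have KR0 : 0 < K%:R :> R by rewrite ltr0n.
have H n : (@lebesgue_measure R) `[n%:R / K%:R, n.+1%:R / K%:R[%classic =
  (K%:R^-1)%:E.
  rewrite lebesgue_measure_itv/= lte_fin ltr_pM2r ?invr_gt0// ltr_nat ltnSn.
  by rewrite -EFinD -mulrBl -natr1 addrAC subrr add0r mul1r.
rewrite /grid_cell product_measure1E; last 2 first.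
- exact: measurable_itv.
- exact: measurable_itv.
transitivity (((K%:R^-1 : R)%:E * (K%:R^-1)%:E)%E).
  by congr (_ * _)%E; exact: H.
by rewrite -EFinM -expr2 exprVn.
Qed.

Lemma grid_cell_inj K p q p' q' z : (0 < K)%N ->
  grid_cell K p q z -> grid_cell K p' q' z -> (p, q) = (p', q').
Proof.
move=> K0; have KR0 : 0 < K%:R :> R by rewrite ltr0n.
have H n n' (y : R) : n%:R / K%:R <= y < n.+1%:R / K%:R ->
    n'%:R / K%:R <= y < n'.+1%:R / K%:R -> n = n'.
  rewrite !ler_pdivrMr// !ltr_pdivlMr// => /andP[a1 a2] /andP[b1 b2].
  apply/eqP; rewrite eqn_leq -ltnS -[(n' <= _)%N]ltnS -!(ltr_nat R).
  by rewrite (le_lt_trans a1 b2) (le_lt_trans b1 a2).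
by move=> [/= z1 z2] [z1' z2']; congr pair; [apply: H z1 z1'|apply: H z2 z2'].
Qed.

End grid.

Section empirical_cells.
Context {R : realType}.
Local Notation X := (quot_space R).
Local Notation leb2 := ((@lebesgue_measure R) \x (@lebesgue_measure R))%E.

Local Notation plane := (measurableTypeR R * measurableTypeR R)%type.

Lemma measurable_square (T : R) : measurable (square T : set plane).
Proof. by apply: measurableX; exact: measurable_itv. Qed.

Lemma square_measure (T : {posnum R}) : leb2 (square T%:num) = (T%:num ^+ 2)%:E.
Proof.
have lebT : (@lebesgue_measure R) `[0%R, T%:num]%classic = T%:num%:E.
  by rewrite lebesgue_measure_itv/= lte_fin gt0//= sube0.
rewrite /square product_measure1E; last 2 first.
- exact: measurable_itv.
- exact: measurable_itv.
transitivity (T%:num%:E * T%:num%:E)%E; first by congr (_ * _)%E; exact: lebT.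
by rewrite -EFinM -expr2.
Qed.

Lemma square_measure_lty (T : {posnum R}) : (leb2 (square T%:num) < +oo)%E.
Proof. by rewrite square_measure ltry. Qed.

Variables (k : nat) (h : 'I_k -> 'M[R]_3) (r : R) (n : nat).
Local Notation itinerary := (itinerary h r).
Local Notation word n := {ffun 'I_n -> 'I_k.+1}.

(** The empirical measure has mass 1, so the lower bound A on the mean of [g] bounds the mean of [b]
    by cmax - A. Times T^2 this is an integral over the square, which contains the P Q cells, each
    of area K^-2. *)
Lemma empirical_cells (T : {posnum R}) (x : X) (g : X -> R) (b : word n -> R)
    (cmax A : R) (K P Q : nat) (m : nat -> nat -> R) :
  measurable_fun setT g -> (forall y, 0 <= g y) ->
  (forall w, 0 <= b w) -> (forall y, g y <= cmax - b (itinerary n y)) ->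
  (A%:E <= \int[empirical T x]_y (g y)%:E)%E ->
  (0 < K)%N -> P%:R / K%:R <= T%:num -> Q%:R / K%:R <= T%:num ->
  (forall p q s t, grid_cell K p q (s, t) ->
    m p q <= b (itinerary n (quot_act (a_elt s t) x))) ->
  \sum_(p < P) \sum_(q < Q) m p q <= K%:R ^+ 2 * T%:num ^+ 2 * (cmax - A).
Proof.
move=> mg g0 b0 gb Ag K0 PT QT mb.
have KR0 : 0 < K%:R :> R by rewrite ltr0n.
have T0 : 0 < T%:num ^+ 2 :> R by rewrite exprn_gt0.
pose mu2 : {finite_measure set plane -> \bar R} :=
  mfrestr (measurable_square T%:num) (square_measure_lty T).
pose phi (p : plane) : X := quot_act (a_elt p.1 p.2) x.
have mphi : measurable_fun setT phi by exact: measurable_a_orbit.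
have pI := @itinerary_partition R k h r n.
have [mI _ _] := pI.
pose I w := [set y : X | itinerary n y = w].
pose S w := phi @^-1` I w.
have mS w : measurable (S w) by rewrite -[X in measurable X]setTI;
  apply: mphi => //; exact: mI.
have pS : finite_partition S.
  split=> //.
  - by apply/trivIsetP => i j _ _ /eqP ij; apply/seteqP; split=> // z [];
      rewrite /S /I /= => zi zj; apply: ij; rewrite -zi -zj.
  - by apply/seteqP; split=> // z _; exists (itinerary n (phi z)).
have empE w : fine (empirical T x (I w)) = (T%:num ^+ 2)^-1 * fine (mu2 (S w)).
  have := @empiricalE R T x (I w) (mI w); rewrite /= => ->.
  rewrite -[X in fine (_ * X)%E]/(mu2 (S w)) fineM//; exact: fin_num_measure.
have sum1 : \sum_w fine (empirical T x (I w)) = 1.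
  have /= := fine_measure_partition (empirical T x) pI measurableT.
  rewrite probability_setT /= => ->.
  by apply: eq_bigr => w _; rewrite setTI.
have gA : A <= \sum_w (cmax - b w) * fine (empirical T x (I w)).
  rewrite -lee_fin (le_trans Ag)//.
  apply: (le_trans (integral_le_sum (c := fun w => cmax - b w) _ pI mg g0 _)).
    by move=> w y /= <-.
  rewrite -sumEFin le_eqVlt; apply/orP; left; apply/eqP; apply: eq_bigr => w _.
  by rewrite EFinM fineK ?fin_num_measure//; exact: mI.
have {}gA : \sum_w b w * fine (mu2 (S w)) <= T%:num ^+ 2 * (cmax - A).
  have -> : \sum_w b w * fine (mu2 (S w)) =
      T%:num ^+ 2 * \sum_w b w * fine (empirical T x (I w)).
    rewrite mulr_sumr; apply: eq_bigr => w _.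
    by rewrite empE mulrCA mulVKf// gt_eqF.
  rewrite ler_wpM2l ?(ltW T0)// lerBrDr -lerBrDl.
  apply: le_trans gA _; under eq_bigr do rewrite mulrBl.
  by rewrite sumrB -mulr_sumr sum1 mulr1.
pose C (c : 'I_P * 'I_Q) := grid_cell K c.1 c.2 : set plane.
have mC c : measurable (C c) by exact: measurable_grid_cell.
have tC : trivIset setT C.
  apply/trivIsetP => -[i j] [i' j'] _ _ /eqP ij; apply/seteqP;
    split=> // z [/= z1 z2].
  have [ii jj] := grid_cell_inj K0 z1 z2.
  by apply: ij; congr pair; apply: val_inj.
have CT c : fine (mu2 (C c)) = (K%:R ^+ 2)^-1.
  rewrite /mu2/= /mfrestr /mrestr (_ : _ `&` _ = C c).
    by rewrite /C grid_cell_measure.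
  apply/setIidl => -[s t] [/= s1 t1]; split; rewrite /= in_itv/=.
  - move: s1; rewrite in_itv/= => /andP[z1 z2];
    rewrite (le_trans _ z1) ?divr_ge0//=.
    rewrite (le_trans (ltW z2))// (le_trans _ PT)// ler_pM2r ?invr_gt0//
      ler_nat.
    exact: ltn_ord.
  - move: t1; rewrite in_itv/= => /andP[z1 z2];
    rewrite (le_trans _ z1) ?divr_ge0//=.
    rewrite (le_trans (ltW z2))// (le_trans _ QT)// ler_pM2r ?invr_gt0//
      ler_nat.
    exact: ltn_ord.
have : \sum_(c : 'I_P * 'I_Q) m c.1 c.2 * fine (mu2 (C c)) <=
    \sum_w b w * fine (mu2 (S w)).
  apply: partition_cells => // c w -[s t] cst /= <-; exact: mb cst.
under eq_bigr do rewrite CT.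
rewrite -mulr_suml -(pair_bigA _ (fun (p : 'I_P) (q : 'I_Q) => m p q))/=.
move=> /le_trans/(_ gA); rewrite ler_pdivrMr ?exprn_gt0//.
by congr (_ <= _); ring.
Qed.

End empirical_cells.

(** * Counting codes *)

Section counting.
Context {R : realType}.

Lemma coverable_bigcup (I : finType) (P : pred I) (S : I -> set (R * R))
    (N : I -> R) (a b : R) :
  (forall i, P i -> coverable (S i) (N i) a b) ->
  coverable (\bigcup_(i in [set i | P i]) S i) (\sum_(i | P i) N i) a b.
Proof.
move=> cov.
have [c cP] : {c : I -> seq (R * R) & forall i, P i ->
    (size (c i))%:R <= N i /\ forall p, S i p -> exists2 q, q \in c i &
      q.1 <= p.1 <= q.1 + a /\ q.2 <= p.2 <= q.2 + b}.
  apply: (@choice _ _ (fun i (ci : seq (R * R)) => P i -> (size ci)%:R <= N i /\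
    forall p, S i p -> exists2 q, q \in ci &
      q.1 <= p.1 <= q.1 + a /\ q.2 <= p.2 <= q.2 + b)) => i.
  have [Pi|nPi] := boolP (P i); last by exists [::].
  by have [ci H] := cov _ Pi; exists ci.
exists (flatten [seq c i | i <- enum P]); split.
  rewrite size_flatten sumnE big_map big_map natr_sum big_enum/=.
  by apply: ler_sum => i Pi; have [] := cP i Pi.
move=> p [i /= Pi Sp]; have [_ /(_ p Sp)[q qc H]] := cP i Pi; exists q => //.
by apply/flattenP; exists (c i) => //; apply: map_f; rewrite mem_enum.
Qed.

Lemma sum_nat_block (V : nmodType) (F : nat -> V) M L :
  \sum_(p < M * L) F p = \sum_(p < L) \sum_(j < M) F (j * L + p)%N.
Proof.
elim: M => [|M IH].
  by rewrite mul0n big_ord0 big1// => p _; rewrite big_ord0.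
under [RHS]eq_bigr do rewrite big_ord_recr/=.
rewrite big_split/= -IH mulSnr -!(big_mkord xpredT F) -(big_mkord xpredT (fun p
  => F (M * L + p)%N)).
rewrite (@big_cat_nat _ _ _ (M * L)%N)//= ?leq_addr//; congr (_ + _).
by rewrite -{1}[(M * L)%N]add0n big_addn addKn; apply: eq_bigr => i _;
  rewrite addnC.
Qed.

Variable k : nat.
Local Notation word n := {ffun 'I_n -> 'I_k.+1}.

(** A total cost at most B leaves 5 times the zeros at most B minus the code lengths, so a summand
    is at most e^B times the product of the e^(- l). Over all W these products add up to the M-th
    power of the Kraft sum. *)
Lemma kraft_count n M (l : word n -> nat) (B : R) :
  \sum_w expR (- (l w)%:R) <= 1 :> R ->
  \sum_(W : {ffun 'I_M -> word n} | ((\sum_j cost l (W j))%:R <= B))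
     expR (5 * (\sum_j zeros (W j))%:R) <= expR B.
Proof.
move=> kraft.
have H (W : {ffun 'I_M -> word n}) : (\sum_j cost l (W j))%:R <= B ->
    expR (5 * (\sum_j zeros (W j))%:R) <= expR B * \prod_j expR (- (l (W
      j))%:R).
  move=> WB; rewrite -expR_sum -expRD ler_expR sumrN.
  move: WB; rewrite /cost big_split/= natrD -big_distrr/= natrM !natr_sum; lra.
apply: (@le_trans _ _ (\sum_(W : {ffun 'I_M -> word n})
    expR B * \prod_j expR (- (l (W j))%:R))).
  rewrite [leRHS](bigID (fun W : {ffun 'I_M -> word n} =>
    (\sum_j cost l (W j))%:R <= B))/= -[leLHS]addr0.
  apply: lerD; first by apply: ler_sum => W; exact: H.
  by apply: sumr_ge0 => W _; rewrite mulr_ge0 ?expR_ge0// prodr_ge0// => *;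
    exact: expR_ge0.
rewrite -mulr_sumr -(bigA_distr_bigA (fun _ w => expR (- (l w)%:R))).
rewrite ler_piMr ?expR_ge0// prodr_const exprn_ile1// sumr_ge0//.
Qed.

(** The M words read as one word of length M n. The default outside this range is symbol 0, which
    imposes no condition in [coded_at]. *)
Definition letter n M (W : {ffun 'I_M -> word n}) (i : nat) : 'I_k.+1 :=
  if insub (i %/ n)%N is Some j then
    if insub (i %% n)%N is Some i' then W j i' else ord0
  else ord0.

Lemma letterE n M (W : {ffun 'I_M -> word n}) (j : 'I_M) (i : 'I_n) :
  letter W (j * n + i)%N = W j i.
Proof.
have n0 : (0 < n)%N by case: n i W => [[]|].
rewrite /letter divnMDl// divn_small// addn0 modnMDl modn_small//.
by rewrite !valK.
Qed.

Lemma letter_neq0 n M (W : {ffun 'I_M -> word n}) i : letter W i != ord0 ->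
  exists (j : 'I_M) (i' : 'I_n), i = (j * n + i')%N /\ letter W i = W j i'.
Proof.
rewrite /letter; case: insubP => [j _ ji|_]; last by rewrite eqxx.
case: insubP => [i' _ ii|_]; last by rewrite eqxx.
by move=> _; exists j, i'; split=> //; rewrite ji ii -divn_eq.
Qed.

Lemma sum_zeros_letter n M (W : {ffun 'I_M -> word n}) :
  (\sum_(i < M * n) ~~ (letter W i != ord0) = \sum_j zeros (W j))%N.
Proof.
rewrite (sum_nat_block (fun i =>
  (~~ (letter W i != ord0) : nat))) exchange_big/=.
apply: eq_bigr => j _; apply: eq_bigr => i _.
by rewrite letterE negbK.
Qed.

End counting.

Section coded_set.
Context {R : realType}.
Local Notation X := (quot_space R).
Variables (x0 : X) (k : nat) (h : 'I_k -> 'M[R]_3) (r : R) (n K : nat) (gamma :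
  R).
Local Notation word := {ffun 'I_n -> 'I_k.+1}.
Variable l : word -> nat.
Local Notation y := (Num.sqrt gamma).

(** The heights stop at y M n instead of y T, so that [coded_set] depends on M and not on the real
    time T. *)
Definition grid_height M : nat := Num.truncn (y * (M * n * K)%:R).

Definition coded_at (M p q : nat) (W : {ffun 'I_M -> word}) (i : nat) (u : horo
  R) :=
  forall a, letter W i = lift ord0 a ->
    orbit_dist (h a) (quot_act (a_elt (p%:R / K%:R + i%:R) (q%:R / K%:R))
      (quot_act u x0)) < r.

(* The point (p / K, q / K) is a corner of the cell of [0, T]^2 containing the
   times at which the words W are observed; the radius r exceeds that of the
   partition in order to absorb the size of the cell. *)
Definition coded_set (M : nat) : set (horo R) := [set u : horo R |
  (`|mx_of u 1 0| <= 2 /\ `|mx_of u 2 0| <= 2) /\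
  exists (p : 'I_(n * K)) (q : 'I_(grid_height M)) (W : {ffun 'I_M -> word}),
    (\sum_j cost l (W j))%:R <= 11 * y * (M * n)%:R /\
    forall i, (i < M * n)%N -> coded_at p q W i u].

Variables (N rho : R).
Hypothesis rho0 : 0 < rho.
Hypothesis hN : forall a, `|h a| <= N.
Hypothesis rigid : forall (h : 'M[R]_3) (x : X) (s t : R) (u v : horo R),
  `|h| <= N ->
  orbit_dist h (quot_act (a_elt s t) (quot_act u x)) < r ->
  orbit_dist h (quot_act (a_elt s t) (quot_act v x)) < r ->
  expR (2 * s + t) * `|mx_of v 1 0 - mx_of u 1 0| <= rho ->
  expR (s + 2 * t) * `|mx_of v 2 0 - mx_of u 2 0| <= rho ->
  expR (2 * s + t) * `|mx_of v 1 0 - mx_of u 1 0| <= expR (- 2) / 2 * rho /\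
  expR (s + 2 * t) * `|mx_of v 2 0 - mx_of u 2 0| <= expR (- 2) / 2 * rho.
Hypothesis K0 : (0 < K)%N.
Hypothesis gamma01 : 0 < gamma < 1.
Hypothesis n6 : 6 <= gamma * n%:R.
Hypothesis kraft : \sum_w expR (- (l w)%:R) <= 1 :> R.

Definition horo_coord (u : horo R) : R * R := (mx_of u 1 0, mx_of u 2 0).

Lemma sqrt_gamma01 : 0 < y < 1.
Proof.
have /andP[g0 g1] := gamma01; rewrite sqrtr_gt0 g0/=.
by rewrite -sqrtr1 ltr_sqrt.
Qed.

Lemma grid_height_le M (q : 'I_(grid_height M)) : q%:R / K%:R <= y * (M * n)%:R.
Proof.
have /andP[y0 _] := sqrt_gamma01.
rewrite ler_pdivrMr ?ltr0n// -mulrA -natrM.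
have : (q : nat)%:R <= (grid_height M)%:R :> R by rewrite ler_nat ltnW//
  ltn_ord.
move=> /le_trans; apply; rewrite truncn_le mulr_ge0// ltW//.
Qed.

Let side M := rho * expR (- (M * n)%:R).

(** The first boxes are those that the flow up to time (s, t) = (p / K, q / K) expands to size rho.
    About e^(3 s + 3 t) of them cover the square, where s <= n and t <= y M n; [coverable_itinerary]
    then follows the M n steps. *)
Lemma coverable_coded M (p : 'I_(n * K)) (q : 'I_(grid_height M))
    (W : {ffun 'I_M -> word}) :
  coverable [set z | (`|z.1| <= 2 /\ `|z.2| <= 2) /\
      exists2 u, horo_coord u = z & forall i, (i < M * n)%N -> coded_at p q W i
        u]
    ((4 / rho + 1) ^+ 2 * expR (3 * n%:R + 3 * y * (M * n)%:R) *
      expR (5 * (\sum_j zeros (W j))%:R))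
    (side M) (side M).
Proof.
pose s : R := p%:R / K%:R; pose t : R := q%:R / K%:R.
have s0 : 0 <= s by rewrite divr_ge0.
have t0 : 0 <= t by rewrite divr_ge0.
have sn : s <= n%:R.
  by rewrite /s ler_pdivrMr ?ltr0n// -natrM ler_nat ltnW// ltn_ord.
have ty : t <= y * (M * n)%:R by exact: grid_height_le.
pose a := rho * expR (- (2 * s + t)); pose b := rho * expR (- (s + 2 * t)).
have a0 : 0 < a by rewrite mulr_gt0 ?expR_gt0.
have b0 : 0 < b by rewrite mulr_gt0 ?expR_gt0.
pose good i : set (R * R) :=
  [set z | exists2 u, horo_coord u = z & coded_at p q W i u].
have rig i z z' : letter W i != ord0 -> good i z -> good i z' ->
    `|z.1 - z'.1| <= expR (- (2 * i%:R)) * a -> `|z.2 - z'.2| <= expR (- i%:R)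
      * b ->
    `|z.1 - z'.1| <= expR (- 2) / 2 * (expR (- (2 * i%:R)) * a) /\
    `|z.2 - z'.2| <= expR (- 2) / 2 * (expR (- i%:R) * b).
  have -> : expR (- (2 * i%:R)) * a = rho / expR (2 * (s + i%:R) + t).
    by rewrite /a mulrCA -expRD -expRN; congr (_ * expR _); ring.
  have -> : expR (- i%:R) * b = rho / expR (s + i%:R + 2 * t).
    by rewrite /b mulrCA -expRD -expRN; congr (_ * expR _); ring.
  move=> Wi [v <- gv] [u <- gu] /=; rewrite ![_ * (rho / _)]mulrA.
  rewrite !ler_pdivlMr ?expR_gt0// ![_ * expR _]mulrC.
  case: (unliftP ord0 (letter W i)) Wi => [c Wc|->]; last by rewrite eqxx.
  move=> _; apply: rigid (hN c) (gu _ Wc) (gv _ Wc).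
have := coverable_itinerary a0 b0 (coverable_square a0 b0) rig (M * n).
rewrite sum_zeros_letter; apply: coverable_sub.
- move=> z [z2 [u uz gu]]; split=> // i iM _; exists u => //; exact: gu.
- rewrite ler_wpM2r ?expR_ge0//.
  have H (c : R) : 0 <= c -> 4 / (rho * expR (- c)) + 1 <= (4 / rho + 1) * expR
    c.
    move=> c0; have c1 : 1 <= expR c by have := expR_ge1Dx c; lra.
    have -> : 4 / (rho * expR (- c)) = 4 / rho * expR c.
      by rewrite invfM -expRN opprK mulrA.
    by lra.
  apply: (@le_trans _ _ ((4 / rho + 1) * expR (2 * s + t) *
      ((4 / rho + 1) * expR (s + 2 * t)))).
    apply: ler_pM; rewrite ?addr_ge0 ?divr_ge0 ?(ltW a0) ?(ltW b0)//.
      by apply: H; lra.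
    by apply: H; lra.
  rewrite mulrACA -expr2 -expRD ler_wpM2l ?exprn_ge0 ?addr_ge0 ?divr_ge0 ?(ltW
    rho0)//.
  by rewrite ler_expR; lra.
- rewrite /a /side mulrCA -expRD ler_wpM2l ?(ltW rho0)// ler_expR.
  have : 0 <= (M * n)%:R :> R by [].
  by lra.
- rewrite /b /side mulrCA -expRD ler_wpM2l ?(ltW rho0)// ler_expR.
  have : 0 <= (M * n)%:R :> R by [].
  by lra.
Qed.

(** The exponent 14 is 3 from the height plus 11 from [kraft_count]; the polynomial factor counts
    the n K phases p and at most n K M heights q. *)
Lemma coverable_coded_set M :
  coverable (horo_coord @` coded_set M)
    ((n * K)%:R ^+ 2 * (4 / rho + 1) ^+ 2 * expR (3 * n%:R) * M%:R *
      expR (14 * y * (M * n)%:R))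
    (side M) (side M).
Proof.
have /andP[y0 y1] := sqrt_gamma01.
pose adm (W : {ffun 'I_M -> word}) :=
  (\sum_j cost l (W j))%:R <= 11 * y * (M * n)%:R.
have cov pq : true -> coverable _ _ (side M) (side M) :=
  fun _ => coverable_bigcup (P := adm)
    (fun (W : {ffun 'I_M -> word}) _ => @coverable_coded M pq.1 pq.2 W).
have := coverable_bigcup (P := xpredT) cov; apply: coverable_sub => //.
  move=> _ [u [u2 [p [q [W [WB uW]]]]] <-]; exists (p, q) => //; exists W =>
    //=.
  by split=> //; exists u.
apply: (@le_trans _ _ (\sum_(pq : 'I_(n * K) * 'I_(grid_height M))
   ((4 / rho + 1) ^+ 2 * expR (3 * n%:R + 3 * y * (M * n)%:R) *
     expR (11 * y * (M * n)%:R)))).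
  apply: ler_sum => pq _; rewrite -mulr_sumr.
  apply: ler_wpM2l (kraft_count _ _ kraft).
  by rewrite mulr_ge0 ?expR_ge0// exprn_ge0// addr_ge0// divr_ge0// ltW.
rewrite sumr_const card_prod !card_ord -[leLHS]mulr_natl natrM.
have E : expR (3 * n%:R + 3 * y * (M * n)%:R) * expR (11 * y * (M * n)%:R) =
   expR (3 * n%:R) * expR (14 * y * (M * n)%:R) :> R.
  by rewrite -!expRD; congr expR; ring.
rewrite -(mulrA ((4 / rho + 1) ^+ 2)) E.
rewrite [leRHS](_ : _ = (n * K)%:R * ((n * K)%:R * M%:R) *
  ((4 / rho + 1) ^+ 2 * (expR (3 * n%:R) * expR (14 * y * (M * n)%:R))));
    last by ring.
have C0 : 0 <= 4 / rho + 1 by rewrite addr_ge0// divr_ge0// ltW.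
rewrite ler_wpM2r//.
  by rewrite !mulr_ge0 ?expR_ge0 ?exprn_ge0.
rewrite ler_wpM2l// (le_trans (y := y * (M * n * K)%:R))//.
  by rewrite truncn_le mulr_ge0// ltW.
rewrite -natrM [(n * K * M)%N]mulnC mulnA.
by rewrite ler_piMl// ltW.
Qed.

(** In dimension 15 y the cover by about e^(14 y M n) squares of side rho e^(- M n) leaves a factor
    e^(- y M n), at most e^(- 6 M) since y >= gamma and gamma n >= 6. Against it stand C, M and 2^(M
    + 1), together at most 2^(3 M + 1). *)
Lemma coded_limsup_null (A : set (horo R)) :
  (forall u M0, A u -> exists2 M, (M0 <= M)%N & coded_set M u) ->
  hausdorff_measure (15 * y) A = 0%E.
Proof.
move=> Alim; have /andP[y0 y1] := sqrt_gamma01.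
apply: (@hausdorff_measure_limsup0 _ _ _ A coded_set) => //.
move=> e e0.
pose C : R := (n * K)%:R ^+ 2 * (4 / rho + 1) ^+ 2 * expR (3 * n%:R) * rho `^
  (15 * y).
(* M >= 1 gives 3 M + 1 <= 6 M, M >= C gives C <= 2^M, and M >= rho / e brings the side below e. *)
pose M0 := maxn 1 (maxn (Num.truncn C).+1 (Num.truncn (rho / e)).+1).
exists M0 => M MM0.
have M1 : (1 <= M)%N by rewrite (leq_trans _ MM0)// leq_maxl.
have MC : C <= M%:R.
  rewrite (le_trans (ltW (truncnS_gt _)))// ler_nat (leq_trans _ MM0)//.
  by rewrite /M0 maxnCA leq_maxl.
have Me : rho / e <= M%:R.
  rewrite (le_trans (ltW (truncnS_gt _)))// ler_nat (leq_trans _ MM0)//.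
  by rewrite /M0 maxnA leq_maxr.
have n1 : (1 <= n)%N by case: (n) n6 => //; rewrite mulr0; lra.
have [c [csize cS]] := coverable_coded_set M.
have d0 : 0 < side M by rewrite mulr_gt0 ?expR_gt0.
exists (side M), [seq [set u : horo R | q.1 <= mx_of u 1 0 <= q.1 + side M /\
  q.2 <= mx_of u 2 0 <= q.2 + side M] | q : R * R <- c]; split.
- rewrite ltW//= /side expRN.
  have H : M%:R <= expR (M * n)%:R :> R.
    have := @expR_ge1Dx R (M * n)%:R; have : M%:R <= (M * n)%:R :> R.
      by rewrite ler_nat leq_pmulr.
    by lra.
  by rewrite ler_pdivrMr ?expR_gt0// mulrC -ler_pdivrMr// (le_trans Me).
- move=> u uM; have /cS[q qc uq] : (horo_coord @` coded_set M) (horo_coord u)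
  by exists u.
  by eexists; first by apply/mapP; exists q.
- move=> F /mapP[q _ ->].
  apply: ge_ereal_sup => _ [->|[u [v [[u1 u2] [v1 v2] ->]]]];
    rewrite lee_fin ?(ltW d0)//.
  rewrite -[mdist u v]/(dU u v) /dU ge_max; move: u1 u2 v1 v2.
  move=> /andP[? ?] /andP[? ?] /andP[? ?] /andP[? ?].
  by rewrite !ler_norml; lra.
- rewrite size_map (le_trans (ler_wpM2r (powR_ge0 _ _) csize))//.
  have -> : side M `^ (15 * y) = rho `^ (15 * y) * expR (- (15 * y * (M *
    n)%:R)).
    rewrite /side powRM ?expR_ge0 ?(ltW rho0)// -expRM; congr (_ * expR _);
      ring.
  rewrite [leLHS](_ : _ = C * M%:R *
      (expR (14 * y * (M * n)%:R) * expR (- (15 * y * (M * n)%:R))));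
        last first.
    by rewrite /C; ring.
  rewrite -expRD (_ : _ + _ = - (y * (M * n)%:R)); last by ring.
  have M2 : M%:R <= (2 ^ M)%:R :> R by rewrite ler_nat ltnW// ltn_expl.
  have yn : 6 * M%:R <= y * (M * n)%:R.
    have gy : gamma = y * y by rewrite -expr2 sqr_sqrtr// ltW//;
      case/andP: gamma01.
    have : 6 <= y * n%:R.
      by apply: (le_trans n6); rewrite {1}gy -mulrA ler_piMl ?(ltW y1)//.
    by move=> /(ler_wpM2l (ler0n R M)); rewrite natrM; lra.
  rewrite expRN ler_pdivrMr ?expR_gt0// [leRHS]mulrC.
  rewrite ler_pdivlMr ?ltr0n ?expn_gt0//.
  apply: (@le_trans _ _ ((2 ^ M)%:R * (2 ^ M)%:R * (2 ^ M.+1)%:R)).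
    rewrite ler_wpM2r// ler_pM//; last exact: le_trans MC M2.
    have C0 : 0 <= 4 / rho + 1 by rewrite addr_ge0// divr_ge0// ltW.
    by rewrite /C !mulr_ge0 ?expR_ge0 ?powR_ge0 ?exprn_ge0.
  rewrite -!natrM -!expnD natrX.
  apply: (@le_trans _ _ (expR 1 ^+ (M + M + M.+1))).
    by rewrite lerXn2r ?nnegrE ?expR_ge0// expR1_ge2.
  rewrite -expRM_natl mulr1 ler_expR; apply: le_trans yn.
  by rewrite -natrM ler_nat; clear -M1; lia.
Qed.

End coded_set.

(** * Selection of a code *)

Section selection.
Context {R : realType}.
Local Notation X := (quot_space R).

Lemma empirical_limit_frequently (x : X) (mu : {finite_measure set X -> \bar R})
    (g : X -> R) (A T0 : R) :
  is_empirical_limit x mu -> continuous g -> vanishes_at_infinity g ->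
  (A%:E < \int[mu]_y (g y)%:E)%E ->
  exists2 T : {posnum R}, T0 <= T%:num &
    (A%:E <= \int[empirical T x]_y (g y)%:E)%E.
Proof.
move=> [T_ [Too cvgT]] cg vg Ag.
have H1 := cvgT g cg vg.
have [N1 _ HN1] : \forall j \near \oo, (A%:E < \int[empirical (T_ j) x]_y (g
  y)%:E)%E.
  exact: (H1 _ (open_nbhs_nbhs (conj (@open_ereal_gt_ereal R A%:E) Ag))).
have [N2 _ HN2] : \forall j \near \oo, T0 <= (T_ j)%:num.
  by move/cvgryPge : Too; exact.
exists (T_ (maxn N1 N2)); first by apply: HN2; rewrite /= leq_maxr.
by apply: ltW; apply: HN1; rewrite /= leq_maxl.
Qed.

(** Columns are grouped by residue modulo L: a residue p and a height q determine M cells spaced L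
    apart, and one of these L D sequences does not exceed the average. For L = n K the cells are n
    time units apart, the length of a word. *)
Lemma block_pigeonhole (m : nat -> nat -> R) (M L D : nat) (S : R) :
  (0 < L)%N -> (0 < D)%N ->
  \sum_(p < M * L) \sum_(q < D) m p q <= S * (L * D)%:R ->
  exists (p : 'I_L) (q : 'I_D), \sum_(j < M) m (j * L + p)%N q <= S.
Proof.
move=> L0 D0 le; apply: contrapT => H.
have {}H (p : 'I_L) (q : 'I_D) : S < \sum_(j < M) m (j * L + p)%N q.
  by rewrite ltNge; apply/negP => H'; apply: H; exists p, q.
move: le; apply/negP; rewrite -ltNge.
rewrite (sum_nat_block (fun p => \sum_(q < D) m p q)).
under eq_bigr do rewrite exchange_big/=.
apply: (@le_lt_trans _ _ (\sum_(p < L) \sum_(q < D) S)).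
  by rewrite !sumr_const !card_ord -mulrnA mulr_natr mulnC.
apply: ltr_sum.
  by apply/hasP; exists (Ordinal L0); rewrite ?mem_index_enum.
move=> p _; apply: ltr_sum => //.
by apply/hasP; exists (Ordinal D0); rewrite ?mem_index_enum.
Qed.

(** Costs are natural numbers, so each grid cell contains a time at which the word is cheapest; its
    cost bounds from below the cost throughout the cell. *)
Lemma nat_minimizer (T : Type) (P : T -> Prop) (b : T -> nat) :
  (exists x, P x) -> exists2 x, P x & forall z, P z -> (b x <= b z)%N.
Proof.
move=> [x0 Px0].
have ex : exists v, `[< exists2 x, P x & b x = v >].
  by exists (b x0); apply/asboolP; exists x0.
case: (ex_minnP ex) => v /asboolP[x Px <-] Hmin; exists x => // z Pz.
by apply: Hmin; apply/asboolP; exists z.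
Qed.

Lemma grid_height_gt0 (gamma : R) n K M : 0 < gamma -> (0 < n)%N -> (0 < K)%N ->
  22 <= Num.sqrt gamma * M%:R -> (0 < grid_height n K gamma M)%N.
Proof.
move=> g0 n0 K0 yM; rewrite /grid_height truncn_gt_nat -mulnA natrM mulrA.
rewrite (le_trans (y := 22 * (n * K)%:R))//; last by rewrite ler_wpM2r.
by rewrite -natrM ler_nat; lia.
Qed.

(** The total cost over the square is compared with 11 y M n for each of the n K D sequences, D
    being the grid height. M >= 42 gives 10 (M + 1)^2 <= 11 M^2 - M^2 / 2, and the spare y M^2 / 2
    pays for the truncation in D, a loss of 11 M, because y M >= 22. *)
Lemma grid_count_le (gamma T : R) n K M : 0 < gamma < 1 -> (0 < n)%N -> (0 <
  K)%N ->
  (42 <= M)%N -> 22 <= Num.sqrt gamma * M%:R -> 0 <= T -> T <= (M.+1 * n)%:R ->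
  K%:R ^+ 2 * T ^+ 2 * (10 * gamma * n%:R) <=
    11 * Num.sqrt gamma * (M * n)%:R * (n * K * grid_height n K gamma M)%:R.
Proof.
move=> /andP[g0 g1] n0 K0 M42 yM T0 TM.
set y := Num.sqrt gamma in yM *.
have y0 : 0 < y by rewrite sqrtr_gt0.
have gy : gamma = y * y by rewrite -expr2 sqr_sqrtr// ltW.
have n1 : 1 <= n%:R :> R by rewrite ler1n.
have K1 : 1 <= K%:R :> R by rewrite ler1n.
have M42R : 42 <= M%:R :> R by rewrite (ler_nat _ 42).
have T2 : T ^+ 2 <= (M.+1 * n)%:R ^+ 2 by rewrite lerXn2r ?nnegrE.
have DE : y * (M * n * K)%:R - 1 <= (grid_height n K gamma M)%:R.
  by rewrite lerBlDr natr1 ltW// truncnS_gt.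
rewrite !natrM -natr1 in T2 DE *.
move: (n%:R) (K%:R) (M%:R) ((grid_height n K gamma M)%:R) n1 K1 M42R T2 DE yM.
move=> a c m D a1 c1 m42 T2 DE ym.
have a0 : 0 < a by lra. have c0 : 0 < c by lra. have m0 : 0 < m by lra.
apply: (@le_trans _ _ (c ^+ 2 * ((m + 1) * a) ^+ 2 * (10 * gamma * a))).
  rewrite ler_wpM2r//; first by rewrite !mulr_ge0// ltW.
  by rewrite ler_wpM2l// exprn_ge0// ltW.
apply: (@le_trans _ _ (11 * y * (m * a) * (a * c * (y * (m * a * c) - 1))));
  last first.
  rewrite ler_wpM2l//; first by rewrite !mulr_ge0// ltW.
  by rewrite ler_wpM2l// mulr_ge0// ltW.
rewrite gy -subr_ge0.
have -> : 11 * y * (m * a) * (a * c * (y * (m * a * c) - 1)) -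
    c ^+ 2 * ((m + 1) * a) ^+ 2 * (10 * (y * y) * a) =
    (a * a * c * y) * (y * (a * c) * (11 * (m * m) - 10 * (m + 1) ^+ 2) - 11 *
      m).
  ring.
rewrite mulr_ge0//; first by rewrite !mulr_ge0// ltW.
have h1 : m * m / 2 <= 11 * (m * m) - 10 * (m + 1) ^+ 2 by rewrite expr2; nra.
have ac1 : 1 <= a * c by nra.
have h2 : y * (m * m / 2) <= y * (a * c) * (11 * (m * m) - 10 * (m + 1) ^+ 2).
  apply: ler_pM => //.
  - exact: ltW.
  - by rewrite divr_ge0// mulr_ge0// ltW.
  - by rewrite ler_pMr.
have h3 : 22 * m <= y * m * m by rewrite ler_wpM2r// ltW.
by lra.
Qed.

End selection.

Section exceptional_points.
Context {R : realType}.
Local Notation X := (quot_space R).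
Local Notation f := (quot_act (a_elt 1 0) : X -> X).
Local Notation word k n := {ffun 'I_n -> 'I_k.+1}.

Lemma diag_group_a_elt (s t : R) : diag_group (a_elt s t).
Proof.
split=> [|i]; first by rewrite /= /a_mx diag_mx_is_diag.
rewrite /= /a_mx !mxE eqxx mulr1n.
by case: i => -[|[|[|//]]] i3 /=; exact: expR_gt0.
Qed.

Lemma floor_dist (x z d : R) : x <= z < x + d -> `|x - z| <= d.
Proof. by rewrite ler_norml => /andP[? ?]; lra. Qed.

(** In each cell the word is read at a time minimizing the cost capped at [cmax]. A word dearer than
    the zero word is then replaced by it, which lowers the cost to the cap and only drops
    conditions; this matches the truncated subtraction bounding [g]. *)
Lemma empirical_label (k : nat) (h : 'I_k -> 'M[R]_3) (r gamma : R) (K n : nat)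
    (l : word k n -> nat) (y : X) (g : X -> R) (T : {posnum R}) (M : nat) :
  let cmax := cost l (zero_word k n) in
  measurable_fun setT g -> (forall z, 0 <= g z) ->
  (forall z, g z <= (cmax - cost l (itinerary h r n z))%:R) ->
  ((cmax%:R - 10 * gamma * n%:R)%:E <= \int[empirical T y]_z (g z)%:E)%E ->
  0 < gamma < 1 -> (0 < n)%N -> (0 < K)%N -> (42 <= M)%N ->
  22 <= Num.sqrt gamma * M%:R -> (M * n)%:R <= T%:num -> T%:num <= (M.+1 *
    n)%:R ->
  exists (p : 'I_(n * K)) (q : 'I_(grid_height n K gamma M))
      (W : {ffun 'I_M -> word k n}),
    (\sum_j cost l (W j))%:R <= 11 * Num.sqrt gamma * (M * n)%:R /\
    forall j : 'I_M, W j = zero_word k n \/ exists s t,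
      grid_cell K (j * (n * K) + p) q (s, t) /\
      W j = itinerary h r n (quot_act (a_elt s t) y).
Proof.
move=> cmax mg g0 gc gA gam01 n0 K0 M42 yM TM TM1.
have /andP[gam0 gam1] := gam01.
have y1 : Num.sqrt gamma < 1 by rewrite -sqrtr1 ltr_sqrt.
have KR0 : 0 < K%:R :> R by rewrite ltr0n.
pose bn w := minn (cost l w) cmax.
pose label w := if (cost l w <= cmax)%N then w else zero_word k n.
have cost_label w : cost l (label w) = bn w.
  by rewrite /label /bn; case: leqP => // /ltnW/minn_idPr ->.
have wit (pq : nat * nat) : exists st, grid_cell K pq.1 pq.2 st /\
    forall st', grid_cell K pq.1 pq.2 st' ->
      (bn (itinerary h r n (quot_act (a_elt st.1 st.2) y)) <=
       bn (itinerary h r n (quot_act (a_elt st'.1 st'.2) y)))%N.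
  have ne : exists st : R * R, grid_cell K pq.1 pq.2 st.
    exists (pq.1%:R / K%:R, pq.2%:R / K%:R).
    by split; rewrite /= in_itv/= lexx/= ltr_pM2r ?invr_gt0// ltr_nat.
  have [st H1 H2] := nat_minimizer
    (fun st : R * R => bn (itinerary h r n (quot_act (a_elt st.1 st.2) y))) ne.
  by exists st.
have [st stP] := choice wit.
pose w pq := itinerary h r n (quot_act (a_elt (st pq).1 (st pq).2) y).
have D0 := grid_height_gt0 gam0 n0 K0 yM.
have L0 : (0 < n * K)%N by rewrite muln_gt0 n0.
have H : \sum_(p < M * (n * K)) \sum_(q < grid_height n K gamma M)
    (bn (w ((p : nat), (q : nat))))%:R <=
    11 * Num.sqrt gamma * (M * n)%:R * (n * K * grid_height n K gamma M)%:R :>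
      R.
  apply: le_trans (grid_count_le gam01 n0 K0 M42 yM (ltW [gt0 of T%:num]) TM1).
  rewrite [10 * _ * _](_ : _ = cmax%:R - (cmax%:R - 10 * gamma * n%:R));
    last by ring.
  apply: (@empirical_cells R k h r n T y g (fun w => (bn w)%:R) _ _ _ _ _
    (fun p q => (bn (w (p, q)))%:R)) => //.
  - move=> z; apply: le_trans (gc z) _.
    by rewrite -natrB ?geq_minr// ler_nat /bn; lia.
  - by rewrite mulnA natrM mulfK ?gt_eqF.
  - rewrite ler_pdivrMr// (le_trans (y := Num.sqrt gamma * (M * n * K)%:R))//.
      by rewrite truncn_le mulr_ge0.
    rewrite natrM mulrA ler_pM2r// (le_trans _ TM)//.
    by rewrite ler_piMl// ltW.
  - move=> p q s t pqst; rewrite ler_nat.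
    by have [_ /(_ (s, t) pqst)] := stP (p, q).
have [p [q pqS]] := @block_pigeonhole R (fun p q =>
  (bn (w (p, q)))%:R) _ _ _ _ L0 D0 H.
exists p, q, [ffun j : 'I_M => label (w ((j * (n * K) + p)%N, (q : nat)))].
split.
  apply: le_trans pqS; rewrite natr_sum; apply: ler_sum => j _.
  by rewrite ffunE cost_label.
move=> j; rewrite ffunE /label; case: ifP => _; last by left.
right; set pq := (_, _); exists (st pq).1, (st pq).2; split=> //.
by rewrite -surjective_pairing; have [+ _] := stP pq.
Qed.

Lemma exceptional_coded (x0 : X) (u : horo R) (mu : {finite_measure set X ->
  \bar R})
    (P0 : probability X R) (gamma N r : R) (k : nat) (h : 'I_k -> 'M[R]_3) (K :
      nat) :
  0 < gamma < 1 -> 0 < r -> (0 < K)%N -> (forall i, `|h i| <= N) ->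
  (forall A, `|A| <= N -> exists i, `|A - h i| < r / 4) ->
  (forall (s t : R) (h : 'M[R]_3) (x : X), `|s| <= K%:R^-1 -> `|t| <= K%:R^-1 ->
    `|h| <= N -> orbit_dist h x < r / 2 ->
    orbit_dist h (quot_act (a_elt s t) x) < r) ->
  is_empirical_limit (quot_act u x0) mu -> A_invariant mu ->
  ((1 - gamma)%:E < mu setT <= 1)%E ->
  (ks_entropy (mnormalize mu P0) f <= gamma%:E)%E ->
  (mu [set x | (N <= orbit_dist 0 x)%R] <= (gamma / 5)%:E)%E ->
  `|mx_of u 1 0| <= 2 -> `|mx_of u 2 0| <= 2 ->
  exists n (l : word k n -> nat), [/\ 6 <= gamma * n%:R,
    \sum_w expR (- (l w)%:R) <= 1 :> R &
    forall M0, exists2 M, (M0 <= M)%N & coded_set x0 h r K gamma l M u].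
Proof.
move=> gam01 r0 K0 hN net thick lim inv /andP[mug mu1] ksg muN u1 u2.
have /andP[g0 g1] := gam01.
have f_mu E : measurable E -> mu (f @^-1` E) = mu E.
  by apply: inv; exact: diag_group_a_elt.
have r24 : r / 4 < r / 2 by lra.
(* Above r / 4 the balls about the net still cover the part where [orbit_dist 0] is below N; below r
   / 2 the enlargement to [r] applies. The radius depends on [mu] and does not survive in the
   conclusion. *)
have [r' /andP[r'1 r'2] thin] := thin_boundary mu
  (fun i => @measurable_orbit_dist R (h i)) r24.
have mu0 : (mu [set x | symbol h r' x = ord0] <= (gamma / 5)%:E)%E.
  apply: le_trans muN; rewrite le_measure ?inE//.
  - by have [] := symbol_partition h r'.
  - rewrite (_ : mkset _ = orbit_dist (0 : 'M[R]_3) @^-1` `[N, +oo[%classic).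
      rewrite -[X in measurable X]setTI.
      by apply: measurable_orbit_dist.
    by apply/seteqP; split=> x /=; rewrite in_itv/= andbT.
  move=> x /= sx0; rewrite leNgt; apply/negP => /orbit_dist_ltP[g gx].
  rewrite subr0 => /ltW/net[i gi].
  have := symbol_eq0 sx0 i; apply/negP; rewrite -ltNge.
  by apply/orbit_dist_ltP; exists g => //; exact: lt_trans gi r'1.
have [n [l [nN kraft costle]]] :=
  cost_bound f_mu (Num.truncn (6 / gamma)).+1 gam01 mug mu1 ksg mu0.
have n6 : 6 <= gamma * n%:R.
  by rewrite mulrC -ler_pdivrMr// (le_trans (ltW (truncnS_gt _)))// ler_nat.
have n0 : (0 < n)%N by exact: leq_ltn_trans nN.
have nR0 : 0 < n%:R :> R by rewrite ltr0n.
exists n, l; split=> // M0.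
pose cmax := cost l (zero_word k n).
(* The subtraction is truncated: words dearer than the zero word gain nothing, and the zero word
   itself gains 0, as [gain_vanishes] requires. *)
pose c (w : word k n) : R := (cmax - cost l w)%:R.
have cC w : 0 <= c w <= cmax%:R by rewrite ler0n ler_nat leq_subr.
have c_ge0 w : 0 <= c w by case/andP: (cC w).
have c0 : c [ffun=> ord0] = 0 by rewrite /c subnn.
(* The loss cmax n k e on the shells is at most gamma n / 2; the other half of the margin between 9
   gamma n and 10 gamma n makes [Ag] strict. *)
pose e : R := gamma / (2 * (cmax%:R * k%:R + 1)).
have e0 : 0 < e by rewrite divr_gt0// mulr_gt0// ltr_wpDl// mulr_ge0.
have [eta eta0 thin_eta] := thin _ e0.
have gain_int := gain_integral f_mu cC eta0 thin_eta.
pose g := gain h r' c eta.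
pose A := cmax%:R - 10 * gamma * n%:R.
have Ag : (A%:E < \int[mu]_z (g z)%:E)%E.
  apply: lt_le_trans gain_int; rewrite lte_fin.
  have H1 : cmax%:R * ((n * k)%:R * e) <= gamma * n%:R / 2.
    rewrite /e natrM [leLHS](_ : _ = gamma * n%:R / 2 *
      (cmax%:R * k%:R / (cmax%:R * k%:R + 1))); last first.
      field; apply/lt0r_neq0; rewrite ltr_wpDl// mulr_ge0//.
    have ck : 0 <= cmax%:R * k%:R :> R by rewrite mulr_ge0.
    rewrite ler_piMr ?divr_ge0 ?mulr_ge0 ?(ltW g0)//.
    by rewrite ler_pdivrMr ?mul1r ?lerDl// ltr_wpDl.
  have mass : \sum_w fine (mu [set x | itinerary h r' n x = w]) = fine (mu
    setT).
    rewrite (fine_measure_partition mu (itinerary_partition h r' n)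
      measurableT).
    by apply: eq_bigr => w _; rewrite setTI.
  have H2 : cmax%:R * fine (mu setT) -
      \sum_w (cost l w)%:R * fine (mu [set x | itinerary h r' n x = w]) <=
      \sum_w c w * fine (mu [set x | itinerary h r' n x = w]).
    rewrite -mass mulr_sumr -sumrB; apply: ler_sum => w _.
    rewrite -mulrBl ler_wpM2r ?fine_ge0// /c lerBlDr -natrD.
    by rewrite (ler_nat R) addnC -leq_subLR.
  have gn0 : 0 < gamma * n%:R by rewrite mulr_gt0.
  move: costle; rewrite -/cmax /A => costle.
  by lra.
pose M1 := maxn M0 (maxn 42 (Num.truncn (22 / Num.sqrt gamma)).+1).
have [T TM1 TA] := empirical_limit_frequently (M1 * n)%:R lim
  (continuous_gain c_ge0 eta0) (gain_vanishes h r' c0 eta) Ag.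
pose M := Num.truncn (T%:num / n%:R).
have MM1 : (M1 <= M)%N.
  by rewrite truncn_ge_nat ?divr_ge0// ler_pdivlMr// -natrM.
exists M; first by rewrite (leq_trans _ MM1)// leq_maxl.
have M42 : (42 <= M)%N.
  by rewrite (leq_trans _ MM1)// /M1 maxnCA leq_maxl.
have sg0 : 0 < Num.sqrt gamma by rewrite sqrtr_gt0.
have yM : 22 <= Num.sqrt gamma * M%:R.
  rewrite mulrC -ler_pdivrMr// (le_trans (ltW (truncnS_gt _)))// ler_nat.
  by rewrite (leq_trans _ MM1)// /M1 maxnA leq_maxr.
have Tn0 : 0 <= T%:num / n%:R by rewrite divr_ge0.
have /andP[MT TM] := truncn_itv Tn0.
have TM' : (M * n)%:R <= T%:num by rewrite natrM -ler_pdivlMr.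
have TM'' : T%:num <= (M.+1 * n)%:R by rewrite natrM -ler_pdivrMr// ltW.
have [p [q [W [WS WP]]]] := empirical_label
  (measurable_continuous_quot (continuous_gain c_ge0 eta0))
  (gain_ge0 h r' c_ge0 eta0) (gain_le h r' c_ge0 eta0) TA gam01 n0 K0 M42 yM
    TM' TM''.
split=> //; exists p, q, W; split=> // i iM a Wia.
have Wi0 : letter W i != ord0 by rewrite Wia eq_sym neq_lift.
have [j [i' [iE Wi]]] := letter_neq0 Wi0.
have [W0|[s [t [[/= sc tc] Wst]]]] := WP j.
  by move: Wi0; rewrite Wi W0 ffunE eqxx.
have KR0 : 0 < K%:R :> R by rewrite ltr0n.
have : symbol h r' (iter i' f (quot_act (a_elt s t) (quot_act u x0))) = lift
  ord0 a.
  by move: Wi; rewrite Wia Wst ffunE => ->.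
move=> /symbol_neq0; rewrite iter_quot_act quot_act_aD add0r => da.
(* The word was read at (s, t), somewhere in the cell. Its corner (j n + p / K, q / K) is within 1 /
   K in each coordinate, so [thick] transfers the estimate to the corner. *)
have E : p%:R / K%:R + i%:R =
    (j * (n * K) + p)%:R / K%:R - s + (i'%:R + s) :> R.
  have -> : (j * (n * K) + p)%:R / K%:R = (j * n)%:R + p%:R / K%:R :> R.
    by rewrite natrD mulrDl mulnA (natrM _ (j * n)) mulfK ?gt_eqF.
  by rewrite iE natrD; ring.
rewrite E -[q%:R / K%:R](subrK t) -quot_act_aD.
apply: thick => //; last exact: lt_trans da r'2.
- by apply: floor_dist; move: sc; rewrite in_itv/= -natr1 mulrDl mul1r.
- by apply: floor_dist; move: tc; rewrite in_itv/= -natr1 mulrDl mul1r.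
Qed.

End exceptional_points.

(** * The exceptional set *)

Section exceptional_set_null.
Context {R : realType}.
Local Notation X := (quot_space R).

(** [closed_ball] is the closure of the open ball, so some v is within 1 of both u and the identity.
    The crude constant 2 suffices, since only a bounded square has to be covered. *)
Lemma closed_ball_horo (u : horo R) : closed_ball (horo1 R) 1 u ->
  `|mx_of u 1 0| <= 2 /\ `|mx_of u 2 0| <= 2.
Proof.
move=> /(_ (ball u 1)) [|v []]; first exact: nbhsx_ballx.
rewrite !ballEmdist /= -[mdist (horo1 R) v]/(dU (horo1 R) v) -[mdist u v]/(dU u
  v).
rewrite /dU !gt_max !mxE/= !sub0r !normrN => /andP[v1 v2] /andP[uv1 uv2].
split.
- by rewrite -[mx_of u 1 0](subrK (mx_of v 1 0)) (le_trans (ler_normD _ _))//;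
  lra.
- by rewrite -[mx_of u 2 0](subrK (mx_of v 2 0)) (le_trans (ler_normD _ _))//;
  lra.
Qed.

(** These sets decrease to the empty set because [orbit_dist 0] is real valued; finiteness of [mu]
    gives continuity from above. *)
Lemma orbit_dist_tight (mu : {finite_measure set X -> \bar R}) (e : R) : 0 < e
  ->
  exists N : nat, (mu [set x | (N.+1%:R <= orbit_dist 0 x)%R] <= e%:E)%E.
Proof.
move=> e0; pose S (N : nat) := [set x : X | N.+1%:R <= orbit_dist 0 x].
have mS N : measurable (S N).
  rewrite (_ : S N = orbit_dist (0 : 'M[R]_3) @^-1` `[N.+1%:R, +oo[%classic).
    rewrite -[X in measurable X]setTI.
    by apply: measurable_orbit_dist.
  by apply/seteqP; split=> x /=; rewrite in_itv/= andbT.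
have S0 : \bigcap_N S N = set0.
  apply/seteqP; split=> // x /(_ (Num.truncn (orbit_dist 0 x)) Logic.I).
  by rewrite /S /= leNgt truncnS_gt.
have := @nonincreasing_cvg_mu _ _ _ mu S _ mS _ _.
rewrite S0 measure0 => H.
have {}H : (mu \o S @ \oo --> 0%E).
  apply: H => //; first by rewrite ltey_eq fin_num_measure.
  move=> m n mn; apply/subsetPset => x; rewrite /S /=; apply: le_trans.
  by rewrite ler_nat ltnS.
have e0' : (0 < e%:E)%E by rewrite lte_fin.
have [N _ HN] : \forall n \near \oo, (mu (S n) < e%:E)%E.
  exact: (H _ (open_nbhs_nbhs (conj (@open_ereal_lt_ereal R e%:E) e0'))).
by exists N; apply/ltW/HN => /=.
Qed.

Lemma exceptional_set_null (x0 : X) (gamma : R) : 0 < gamma < 1 ->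
  hausdorff_measure (15 * Num.sqrt gamma) (exceptional_set x0 gamma) = 0%E.
Proof.
move=> gam01; have /andP[g0 g1] := gam01.
pose Z (N : nat) : set (horo R) := [set u |
  closed_ball (horo1 R) 1 u /\
    exists mu : {finite_measure set X -> \bar R},
      [/\ is_empirical_limit (quot_act u x0) mu, A_invariant mu,
          ((1 - gamma)%:E < mu setT <= 1)%E,
          (ks_entropy (mnormalize mu \d_x0) (quot_act (a_elt 1 0))
             <= gamma%:E)%E &
          (mu [set x | (N.+1%:R <= orbit_dist 0 x)%R] <= (gamma / 5)%:E)%E]].
(* Splitting by N lets [r], [rho], K and the net be fixed before any point u or measure [mu]. *)
apply: (@hausdorff_measure_sub0 _ _ _ _ (\bigcup_N Z N)).
  move=> u [u1 [mu [lim inv mass ent]]].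
  have [N muN] : exists N : nat,
      (mu [set x | (N.+1%:R <= orbit_dist 0 x)%R] <= (gamma / 5)%:E)%E.
    by apply: orbit_dist_tight; rewrite divr_gt0.
  by exists N => //; split=> //; exists mu.
apply: hausdorff_measure_bigcup0 => N.
have N0 : 0 < N.+1%:R :> R by [].
(* One time step expands the first coordinate by e^2; the extra 1 / 2 is for the recentring of boxes
   in [coverable_contract]. *)
have c0 : 0 < expR (- 2) / 2 :> R by rewrite divr_gt0 ?expR_gt0.
have [r [rho [r0 rho0 rigid]]] := horo_rigidity N0 c0.
have [K K0 thick] := orbit_dist_thicken N0 r0.
have r40 : 0 < r / 4 by rewrite divr_gt0.
have [k [h [hN net]]] := mx_net (ltW N0) r40.
(* Length functions are stored as finite functions so that the parameters form a countable type. *)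
pose param := {n : nat & {ffun {ffun 'I_n -> 'I_k.+1} -> nat}}.
pose good (nl : param) := 6 <= gamma * (tag nl)%:R /\
  \sum_w expR (- (tagged nl w)%:R) <= 1 :> R.
pose B (nl : param) : set (horo R) := [set u | good nl /\
  forall M0, exists2 M, (M0 <= M)%N & coded_set x0 h r K gamma (tagged nl) M u].
apply: (@hausdorff_measure_sub0 _ _ _ _ (\bigcup_nl B nl)).
  move=> u [u1 [mu [lim inv mass ent muN]]].
  have [u2 u3] := closed_ball_horo u1.
  have [n [l [n6 kraft limsup]]] :=
    exceptional_coded gam01 r0 K0 hN net thick lim inv mass ent muN u2 u3.
  pose nl : param := existT _ n [ffun w => l w].
  have lE : l = tagged nl :> (_ -> _) by apply/funext => w /=; rewrite ffunE.
  exists nl => //; split; first by split=> //; rewrite -lE.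
  by move=> M0; have [M M0M] := limsup M0; exists M => //; rewrite -lE.
apply: hausdorff_measure_bigcup0 => nl.
have [[n6 kraft]|ngood] := pselect (good nl); last first.
  rewrite (_ : B nl = set0) ?hausdorff_measure_set0//.
  by apply/seteqP; split=> // u [].
apply: (coded_limsup_null (x0 := x0) rho0 hN rigid K0 gam01 n6 kraft).
by move=> u M0 [_ H]; exact: H.
Qed.

End exceptional_set_null.

Theorem theorem1p8 (R : realType) (x0 : quot_space R) (gamma : R)
    (gamma_gt0 : 0 < gamma) (gamma_lt1 : gamma < 1) :
  (hausdorff_dim (exceptional_set x0 gamma) <= (15 * Num.sqrt gamma)%:E)%E.
Proof.
apply: hausdorff_dim_le; first by rewrite mulr_ge0// sqrtr_ge0.
by apply: exceptional_set_null; rewrite gamma_gt0.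
Qed.
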